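(* (In $\mathbf{ZF}$.) The following conditions (i)–(iii) are all equivalent: (i) $\mathbf{CUC}$: for every countable family $\mathcal{A}$ of countable sets, the union $\bigcup\mathcal{A}$ is a countable set; (ii) for every topological space $\mathbf{X}$ such that $\mathbf{X}$ has a cuf base, every uncountable subset $A$ of $X$ has a condensation point $x$ in $\mathbf{X}$ such that $x\in A$; (iii) for every second-countable space $\mathbf{X}$, every uncountable subset $A$ of $X$ has a condensation point $x$ in $\mathbf{X}$ such that $x\in A$. Furthermore, (iii)$\rightarrow$(iv)$\rightarrow$(v), where: (iv) every uncountable subset $A$ of $\mathbb{R}$ has a condensation point $x$ in $\mathbb{R}$ such that $x\in A$; (v) $\mathbf{CAC}_{\omega}(\mathbb{R})$: every denumerable family of countable non-empty subsets of $\mathbb{R}$ has a choice function.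
   Context: The result is a theorem of $\mathbf{ZF}$ (Zermelo–Fraenkel set theory without the axiom of choice). A set is countable if it is equipotent with a subset of $\omega$, uncountable otherwise, and denumerable if it is countable and infinite. A set is a cuf set if it is expressible as a countable union of finite sets. A topological space has a cuf base if it has an open base which is a cuf set. For an uncountable subset $A$ of a topological space $\mathbf{X}$, a point $x\in X$ is a condensation point of $A$ in $\mathbf{X}$ if, for every open set $U$ with $x\in U$, the set $A\cap U$ is uncountable. $\mathbb{R}$ carries its standard topology. *)

(* Defs.v *)
(** A theorem of ZF is rendered as a statement about an arbitrary Tarski model
    of first-order ZF.  The separation and replacement schemas range over
    first-order formulas with parameters, not over all Rocq predicates: with
    choice in the metatheory, the second-order schemas would make the axiom of
    choice hold in every model.  Every set-theoretic notion below is a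
    first-order property: it quantifies over elements of the model only. *)

Set Implicit Arguments.
Unset Strict Implicit.

Record set_structure := SetStructure {
  carrier :> Type;
  mem : carrier -> carrier -> Prop }.

Notation "x ∈ a" := (mem x a) (at level 70, no associativity).

(** ** First-order formulas (de Bruijn indices) *)

Inductive formula : Type :=
  | fMem (i j : nat)
  | fEq (i j : nat)
  | fFalse
  | fImp (p q : formula)
  | fAnd (p q : formula)
  | fOr (p q : formula)
  | fAll (p : formula)
  | fEx (p : formula).

Definition scons (M : Type) (x : M) (e : nat -> M) (n : nat) : M :=
  match n with 0 => x | S k => e k end.

Fixpoint sat (M : set_structure) (e : nat -> M) (p : formula) : Prop :=
  match p with
  | fMem i j => e i ∈ e j
  | fEq i j => e i = e j
  | fFalse => False
  | fImp p q => sat e p -> sat e q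
  | fAnd p q => sat e p /\ sat e q
  | fOr p q => sat e p \/ sat e q
  | fAll p => forall x : M, sat (scons x e) p
  | fEx p => exists x : M, sat (scons x e) p
  end.

(** ** Basic set-theoretic vocabulary *)

Definition subset (M : set_structure) (a b : M) : Prop :=
  forall x, x ∈ a -> x ∈ b.

Notation "a ⊆ b" := (subset a b) (at level 70, no associativity).

Definition is_empty (M : set_structure) (a : M) : Prop :=
  forall x, ~ x ∈ a.

Definition is_upair (M : set_structure) (p a b : M) : Prop :=
  forall x, x ∈ p <-> x = a \/ x = b.

(** Kuratowski: [p = {{a}, {a, b}}]. *)
Definition is_opair (M : set_structure) (p a b : M) : Prop :=
  forall x, x ∈ p <-> is_upair x a a \/ is_upair x a b.

Definition is_union (M : set_structure) (u F : M) : Prop :=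
  forall x, x ∈ u <-> exists a, a ∈ F /\ x ∈ a.

Definition is_inter (M : set_structure) (i a b : M) : Prop :=
  forall x, x ∈ i <-> x ∈ a /\ x ∈ b.

Definition is_powerset (M : set_structure) (p a : M) : Prop :=
  forall x, x ∈ p <-> x ⊆ a.

Definition is_prod (M : set_structure) (p a b : M) : Prop :=
  forall z, z ∈ p <-> exists x y, x ∈ a /\ y ∈ b /\ is_opair z x y.

Definition is_succ (M : set_structure) (s x : M) : Prop :=
  forall y, y ∈ s <-> y ∈ x \/ y = x.

Definition inductive_set (M : set_structure) (a : M) : Prop :=
  (exists e, is_empty e /\ e ∈ a) /\
  (forall x, x ∈ a -> exists s, is_succ s x /\ s ∈ a).

Definition is_omega (M : set_structure) (w : M) : Prop :=
  inductive_set w /\ forall a, inductive_set a -> w ⊆ a.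

(** ** The axioms of ZF *)

Record ZF (M : set_structure) : Prop := {
  ZF_extensionality : forall a b : M, (forall x, x ∈ a <-> x ∈ b) -> a = b;
  ZF_foundation : forall a : M,
    (exists x, x ∈ a) -> exists x, x ∈ a /\ forall y, y ∈ x -> ~ y ∈ a;
  ZF_pairing : forall a b : M, exists p, is_upair p a b;
  ZF_union : forall F : M, exists u, is_union u F;
  ZF_powerset : forall a : M, exists p, is_powerset p a;
  ZF_infinity : exists a : M, inductive_set a;
  ZF_separation : forall (p : formula) (e : nat -> M) (a : M),
    exists b, forall x, x ∈ b <-> x ∈ a /\ sat (scons x e) p;
  ZF_replacement : forall (p : formula) (e : nat -> M) (a : M),
    (forall x y z, x ∈ a ->
       sat (scons x (scons y e)) p -> sat (scons x (scons z e)) p -> y = z) ->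
    exists b, forall y,
      y ∈ b <-> exists x, x ∈ a /\ sat (scons x (scons y e)) p }.

(** ** Relations, functions, cardinality *)

(** [(x, y) ∈ r]; for a function [f], [related f x y] means [f(x) = y]. *)
Definition related (M : set_structure) (r x y : M) : Prop :=
  exists p, is_opair p x y /\ p ∈ r.

Definition is_relation (M : set_structure) (r a b : M) : Prop :=
  forall p, p ∈ r -> exists x y, x ∈ a /\ y ∈ b /\ is_opair p x y.

Definition is_function (M : set_structure) (f a b : M) : Prop :=
  is_relation f a b /\
  forall x, x ∈ a -> exists! y, y ∈ b /\ related f x y.

Definition is_bijection (M : set_structure) (f a b : M) : Prop :=
  is_function f a b /\
  forall y, y ∈ b -> exists! x, x ∈ a /\ related f x y.

Definition equipotent (M : set_structure) (a b : M) : Prop :=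
  exists f, is_bijection f a b.

Definition finite (M : set_structure) (a : M) : Prop :=
  exists w n, is_omega w /\ n ∈ w /\ equipotent a n.

Definition countable (M : set_structure) (a : M) : Prop :=
  exists w s, is_omega w /\ s ⊆ w /\ equipotent a s.

Definition uncountable (M : set_structure) (a : M) : Prop := ~ countable a.

Definition denumerable (M : set_structure) (a : M) : Prop :=
  countable a /\ ~ finite a.

Definition cuf (M : set_structure) (a : M) : Prop :=
  exists F, countable F /\ (forall b, b ∈ F -> finite b) /\ is_union a F.

Definition is_choice_function (M : set_structure) (f F : M) : Prop :=
  exists u, is_union u F /\ is_function f F u /\
    forall a x, a ∈ F -> related f a x -> x ∈ a.

(** ** Topological spaces *)

(** [T] is the family of open sets of the space with underlying set [X]. *)
Record topological_space (M : set_structure) (X T : M) : Prop := {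
  top_subset : forall U, U ∈ T -> U ⊆ X;
  top_empty : forall U, is_empty U -> U ∈ T;
  top_full : X ∈ T;
  top_inter : forall U V W, U ∈ T -> V ∈ T -> is_inter W U V -> W ∈ T;
  top_union : forall F U, F ⊆ T -> is_union U F -> U ∈ T }.

Definition is_base (M : set_structure) (B T : M) : Prop :=
  B ⊆ T /\ forall U, U ∈ T -> exists F, F ⊆ B /\ is_union U F.

Definition second_countable (M : set_structure) (T : M) : Prop :=
  exists B, is_base B T /\ countable B.

Definition has_cuf_base (M : set_structure) (T : M) : Prop :=
  exists B, is_base B T /\ cuf B.

Definition condensation_point (M : set_structure) (X T A x : M) : Prop :=
  x ∈ X /\
  forall U, U ∈ T -> x ∈ U -> exists I, is_inter I A U /\ uncountable I.

Definition uncountable_subsets_condense (M : set_structure) (X T : M) : Prop :=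
  forall A, A ⊆ X -> uncountable A ->
    exists x, x ∈ A /\ condensation_point X T A x.

(** ** The real line of a model *)

Definition binary_operation (M : set_structure) (op R : M) : Prop :=
  exists P, is_prod P R R /\ is_function op P R.

(** [op(x, y) = z]. *)
Definition op_value (M : set_structure) (op x y z : M) : Prop :=
  exists p, is_opair p x y /\ related op p z.

Definition upper_bound (M : set_structure) (R lt S b : M) : Prop :=
  b ∈ R /\ forall x, x ∈ S -> related lt x b \/ x = b.

(** [(R, add, mul, lt)] is a Dedekind-complete ordered field inside the model;
    such a structure exists in every model of ZF and is unique up to
    isomorphism. *)
Record real_numbers (M : set_structure) (R add mul lt zero one : M) : Prop := {
  real_zero : zero ∈ R;
  real_one : one ∈ R;
  real_one_neq_zero : one <> zero;
  real_add : binary_operation add R;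
  real_mul : binary_operation mul R;
  real_addC : forall x y z, x ∈ R -> y ∈ R ->
    op_value add x y z -> op_value add y x z;
  real_mulC : forall x y z, x ∈ R -> y ∈ R ->
    op_value mul x y z -> op_value mul y x z;
  real_addA : forall x y z u v w, x ∈ R -> y ∈ R -> z ∈ R ->
    op_value add x y u -> op_value add u z w -> op_value add y z v ->
    op_value add x v w;
  real_mulA : forall x y z u v w, x ∈ R -> y ∈ R -> z ∈ R ->
    op_value mul x y u -> op_value mul u z w -> op_value mul y z v ->
    op_value mul x v w;
  real_add0 : forall x, x ∈ R -> op_value add x zero x;
  real_mul1 : forall x, x ∈ R -> op_value mul x one x;
  real_opp : forall x, x ∈ R -> exists y, y ∈ R /\ op_value add x y zero;
  real_inv : forall x, x ∈ R -> x <> zero ->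
    exists y, y ∈ R /\ op_value mul x y one;
  real_distr : forall x y z s u v w, x ∈ R -> y ∈ R -> z ∈ R ->
    op_value add y z s -> op_value mul x s w ->
    op_value mul x y u -> op_value mul x z v ->
    op_value add u v w;
  real_lt : is_relation lt R R;
  real_lt_irrefl : forall x, x ∈ R -> ~ related lt x x;
  real_lt_trans : forall x y z, x ∈ R -> y ∈ R -> z ∈ R ->
    related lt x y -> related lt y z -> related lt x z;
  real_lt_total : forall x y, x ∈ R -> y ∈ R ->
    related lt x y \/ x = y \/ related lt y x;
  real_lt_add : forall x y z u v, x ∈ R -> y ∈ R -> z ∈ R ->
    related lt x y -> op_value add x z u -> op_value add y z v ->
    related lt u v;
  real_lt_mul : forall x y z, x ∈ R -> y ∈ R ->
    related lt zero x -> related lt zero y -> op_value mul x y z ->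
    related lt zero z;
  real_complete : forall S, S ⊆ R -> (exists x, x ∈ S) ->
    (exists b, upper_bound R lt S b) ->
    exists s, upper_bound R lt S s /\
      forall b, upper_bound R lt S b -> related lt s b \/ s = b }.

(** The topology of unions of open intervals of [(R, lt)]. *)
Definition standard_topology (M : set_structure) (R lt T : M) : Prop :=
  forall U, U ∈ T <->
    U ⊆ R /\
    forall x, x ∈ U -> exists a b,
      a ∈ R /\ b ∈ R /\ related lt a x /\ related lt x b /\
      forall y, y ∈ R -> related lt a y -> related lt y b -> y ∈ U.

(** ** The conditions *)

Definition CUC (M : set_structure) : Prop :=
  forall F u : M, countable F -> (forall a, a ∈ F -> countable a) ->
    is_union u F -> countable u.

Definition cuf_base_condensation (M : set_structure) : Prop :=
  forall X T : M, topological_space X T -> has_cuf_base T ->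
    uncountable_subsets_condense X T.

Definition second_countable_condensation (M : set_structure) : Prop :=
  forall X T : M, topological_space X T -> second_countable T ->
    uncountable_subsets_condense X T.

Definition real_condensation (M : set_structure) (R lt : M) : Prop :=
  forall T, standard_topology R lt T -> uncountable_subsets_condense R T.

(** CAC_ω(R). *)
Definition CAC_omega (M : set_structure) (R : M) : Prop :=
  forall F : M, denumerable F ->
    (forall a, a ∈ F -> a ⊆ R /\ countable a /\ exists x, x ∈ a) ->
    exists f, is_choice_function f F.

(* Main.v *)
From HB Require Import structures.
From mathcomp Require Import all_boot all_order all_algebra boolp ring lra.
Require Import Defs.

Set Implicit Arguments.
Unset Strict Implicit.

(** The argument is carried out with class functions of the model.  A predicate
    or a function on [M] is definable when a first-order formula with parameters
    defines it; definite description [the], comprehension [sep] and images [img]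
    preserve definability, and the separation and replacement schemas apply to
    exactly the definable classes.  In this language a set is countable iff it
    has a definable injection into [ω] ([countableE]), and a set is countable as
    soon as each of its elements has definable names in [ω], no two elements
    sharing a name ([cnt_names]): the least name is an injection, so images of
    countable sets are countable without choice.  Products are handled by an
    explicit enumeration of [ω × ω] obtained by recursion ([walk_surj]).

    CUC implies condensation for cuf bases ([CUC_condensation]): by CUC a cuf base
    is countable; if no point of [A] condenses, the members of the base with a
    countable trace on [A] cover [A], so [A] is countable by CUC again.  A
    countable base is a cuf set, because it is the union of its singletons
    ([second_countable_cuf]).  Conversely ([second_condensation_CUC]), given
    countably many countable sets, attach to each point of their union the set
    with the least number that contains it.  The fibres of this map are a countable
    base of a topology on the union, and each point has a countable
    neighbourhood, its fibre; hence the union is countable.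

    The real line is second countable: the elements of its underlying set form
    an ordered field in which the quotients [(a - b) / c] of natural numbers are
    countable ([cnt_rationals]) and dense ([rationals_dense]), and the intervals
    between them are a base.  Finally let countably many countable non-empty sets of
    reals be given ([real_condensation_choice]).  The map
    [x |-> n + x / (2 (1 + |x|))] copies the set with number [n] into the open
    interval of length 1 around [n], and these intervals are disjoint.  No point
    of the union [A] of the copies condenses, since the interval around its
    number meets [A] in a countable set.  So [A] is countable, and an
    enumeration of [A] selects an element of each of the sets. *)

(** * First-order definability with parameters *)

Section Definability.
Variable M : set_structure.
Implicit Types (e : nat -> M) (P Q : (nat -> M) -> Prop) (t u v : (nat -> M) -> M).

(** Renaming of the free variables of a formula. *)
Definition rename_up (f : nat -> nat) (n : nat) : nat :=
  match n with 0 => 0 | S k => S (f k) end.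

Fixpoint rename (f : nat -> nat) (p : formula) : formula :=
  match p with
  | fMem i j => fMem (f i) (f j)
  | fEq i j => fEq (f i) (f j)
  | fFalse => fFalse
  | fImp p q => fImp (rename f p) (rename f q)
  | fAnd p q => fAnd (rename f p) (rename f q)
  | fOr p q => fOr (rename f p) (rename f q)
  | fAll p => fAll (rename (rename_up f) p)
  | fEx p => fEx (rename (rename_up f) p)
  end.

Lemma sat_rename (p : formula) (f : nat -> nat) e e' :
  (forall i, e (f i) = e' i) -> sat e (rename f p) <-> sat e' p.
Proof.
elim: p f e e' => [i j|i j||p IHp q IHq|p IHp q IHq|p IHp q IHq|p IHp|p IHp]
  f e e' E /=; rewrite ?E //.
- by rewrite (IHp f e e' E) (IHq f e e' E).
- by rewrite (IHp f e e' E) (IHq f e e' E).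
- by rewrite (IHp f e e' E) (IHq f e e' E).
- by split=> H x; move/(_ x): H; apply IHp; case=> [|i] //=; rewrite E.
- by split=> -[x H]; exists x; move: H; apply IHp; case=> [|i] //=; rewrite E.
Qed.

(** The variables of a formula are assigned either a variable of the
    environment or a fixed parameter. *)
Definition assign (s : nat -> nat + M) e (i : nat) : M :=
  match s i with inl j => e j | inr c => c end.

(** A predicate on environments is definable when a first-order formula with
    parameters in the model defines it. *)
Definition D P : Prop :=
  exists (p : formula) (s : nat -> nat + M), forall e, sat (assign s e) p <-> P e.

(** A definable term: its graph, with the value as variable 0, is definable. *)
Definition DT t : Prop := D (fun e => e 0 = t (fun k => e (S k))).

(** Definable predicates of one, two and three arguments, definable functions of
    one and two arguments. *)
Definition D1 (P : M -> Prop) := D (fun e => P (e 0)).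
Definition D2 (P : M -> M -> Prop) := D (fun e => P (e 0) (e 1)).
Definition D3 (P : M -> M -> M -> Prop) := D (fun e => P (e 0) (e 1) (e 2)).
Definition DT1 (F : M -> M) := DT (fun e => F (e 0)).
Definition DT2 (F : M -> M -> M) := DT (fun e => F (e 0) (e 1)).

Lemma D_ext P Q : D P -> (forall e, P e <-> Q e) -> D Q.
Proof. by move=> [p [s H]] E; exists p, s => e; rewrite H. Qed.

Lemma D_const (A : Prop) : D (fun _ => A).
Proof.
case: (pselect A) => H.
- by exists (fImp fFalse fFalse), (fun i => inl i) => e /=; split.
- by exists fFalse, (fun i => inl i) => e /=; split.
Qed.

Lemma DT_var i : DT (fun e => e i).
Proof.
exists (fEq 0 1), (fun k => inl (if k is 0 then 0 else S i)) => e.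
by rewrite /= /assign.
Qed.

Lemma DT_const (c : M) : DT (fun _ => c).
Proof.
exists (fEq 0 1), (fun k => if k is 0 then inl 0 else inr c) => e.
by rewrite /= /assign.
Qed.

Lemma D_rename P (f : nat -> nat) : D P -> D (fun e => P (fun i => e (f i))).
Proof.
move=> [p [s H]].
exists p, (fun i => match s i with inl j => inl (f j) | inr c => inr c end) => e.
rewrite -H; suff -> : assign (fun i => match s i with inl j => inl (f j) | inr c => inr c end) e
  = assign s (fun i => e (f i)) by [].
by apply: funext => i; rewrite /assign; case: (s i).
Qed.

(** Two formulas with parameters can be given a common assignment: the variables
    of one are made even, those of the other odd. *)
Lemma D_pair P Q : D P -> D Q ->
  exists p q s, forall e, (sat (assign s e) p <-> P e) /\ (sat (assign s e) q <-> Q e).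
Proof.
move=> [p [s Hp]] [q [r Hq]].
exists (rename double p), (rename (fun i => (double i).+1) q),
  (fun i => if odd i then r i./2 else s i./2) => e; split.
- by rewrite -Hp; apply: sat_rename => i; rewrite /assign odd_double doubleK.
- rewrite -Hq; apply: sat_rename => i.
  by rewrite /assign /= odd_double /= uphalf_double.
Qed.

Lemma D_and P Q : D P -> D Q -> D (fun e => P e /\ Q e).
Proof.
move=> HP HQ; case: (D_pair HP HQ) => p [q [s H]].
by exists (fAnd p q), s => e /=; case: (H e) => -> ->.
Qed.

Lemma D_or P Q : D P -> D Q -> D (fun e => P e \/ Q e).
Proof.
move=> HP HQ; case: (D_pair HP HQ) => p [q [s H]].
by exists (fOr p q), s => e /=; case: (H e) => -> ->.
Qed.

Lemma D_imp P Q : D P -> D Q -> D (fun e => P e -> Q e).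
Proof.
move=> HP HQ; case: (D_pair HP HQ) => p [q [s H]].
by exists (fImp p q), s => e /=; case: (H e) => -> ->.
Qed.

Lemma D_iff P Q : D P -> D Q -> D (fun e => P e <-> Q e).
Proof. by move=> HP HQ; apply: D_and; apply: D_imp. Qed.

Lemma D_not P : D P -> D (fun e => ~ P e).
Proof. by move=> HP; apply: D_imp => //; apply: D_const. Qed.

(** Splitting off variable 0 of a definable predicate as a genuine variable of
    the formula. *)
Lemma D_head (Q : M -> (nat -> M) -> Prop) :
  D (fun e => Q (e 0) (fun k => e (S k))) ->
  exists p s, forall e x, sat (scons x (assign s e)) p <-> Q x e.
Proof.
move=> [p [s H]].
exists (rename (fun i => if s i is inl 0 then 0 else S i) p),
  (fun i => match s i with inl (S j) => inl j | inl 0 => inl 0 | inr c => inr c end) => e x.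
rewrite -(H (scons x e)); apply: sat_rename => i.
by rewrite /assign; case E: (s i) => [[|j]|c] //=; rewrite E.
Qed.

Lemma D_all (Q : M -> (nat -> M) -> Prop) :
  D (fun e => Q (e 0) (fun k => e (S k))) -> D (fun e => forall x, Q x e).
Proof.
move=> /D_head [p [s H]]; exists (fAll p), s => e /=.
by split=> K x; apply/H/K.
Qed.

Lemma D_ex (Q : M -> (nat -> M) -> Prop) :
  D (fun e => Q (e 0) (fun k => e (S k))) -> D (fun e => exists x, Q x e).
Proof.
move=> /D_head [p [s H]]; exists (fEx p), s => e /=.
by split=> -[x K]; exists x; apply/H/K.
Qed.

Lemma D_subst (Q : M -> (nat -> M) -> Prop) t :
  D (fun e => Q (e 0) (fun k => e (S k))) -> DT t -> D (fun e => Q (t e) e).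
Proof.
move=> HQ Ht; apply: (D_ext (P := fun e => exists x, x = t e /\ Q x e)).
- exact/D_ex/D_and.
- by move=> e; split=> [[x [-> ]]|] //; exists (t e).
Qed.

Lemma D_app1 (P : M -> Prop) t : D1 P -> DT t -> D (fun e => P (t e)).
Proof. exact: (D_subst (Q := fun x _ => P x)). Qed.

Lemma DT_shift t : DT t -> DT (fun e => t (fun k => e (S k))).
Proof. exact: (D_rename (fun i => if i is 0 then 0 else S i)). Qed.

Lemma D_app2 (P : M -> M -> Prop) t u :
  D2 P -> DT t -> DT u -> D (fun e => P (t e) (u e)).
Proof.
move=> HP Ht Hu; apply: (D_subst (Q := fun x e => P x (u e))) => //.
apply: (D_subst (Q := fun y e => P (e 0) y)); last exact: DT_shift.
exact: (D_rename (fun i => if i is 0 then 1 else 0) HP).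
Qed.

Lemma D_app3 (P : M -> M -> M -> Prop) t u v :
  D3 P -> DT t -> DT u -> DT v -> D (fun e => P (t e) (u e) (v e)).
Proof.
move=> HP Ht Hu Hv; apply: (D_subst (Q := fun x e => P x (u e) (v e))) => //.
apply: (D_subst (Q := fun y e => P (e 0) y (v (fun k => e (S k)))));
  last exact: DT_shift.
apply: (D_subst (Q := fun z e => P (e 1) (e 0) z)); last exact: (DT_shift (DT_shift Hv)).
exact: (D_rename (fun i => match i with 0 => 2 | 1 => 1 | _ => 0 end) HP).
Qed.

Lemma D_mem : D2 (@Defs.mem M).
Proof. by exists (fMem 0 1), (fun i => inl i). Qed.

Lemma D_eq : D2 (@eq M).
Proof. by exists (fEq 0 1), (fun i => inl i). Qed.

Lemma DT_app1 (F : M -> M) t : DT1 F -> DT t -> DT (fun e => F (t e)).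
Proof.
move=> HF Ht; apply: (D_app2 (P := fun x y => x = F y)) (DT_shift Ht) => //.
exact: DT_var.
Qed.

Lemma DT_app2 (F : M -> M -> M) t u :
  DT2 F -> DT t -> DT u -> DT (fun e => F (t e) (u e)).
Proof.
move=> HF Ht Hu.
apply: (D_app3 (P := fun x y z => x = F y z)) (DT_shift Ht) (DT_shift Hu) => //.
exact: DT_var.
Qed.

(** The same for variables 0 and 1, the others being irrelevant. *)
Lemma D_head2 (Q : M -> M -> Prop) : M -> D2 Q ->
  exists p e, forall x y, sat (scons x (scons y e)) p <-> Q x y.
Proof.
move=> c0 [p [s H]].
exists (rename (fun i => match s i with inl 0 => 0 | inl 1 => 1 | _ => i.+2 end) p),
  (fun i => if s i is inr c then c else c0) => x y.
rewrite -(H (scons x (scons y (fun=> c0)))); apply: sat_rename => i.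
by rewrite /assign; case E: (s i) => [[|[|j]]|c] //=; rewrite E.
Qed.

End Definability.

(* The axioms are passed to the set-theoretic operations by instance resolution. *)
Existing Class ZF.

(** * Set-theoretic operations *)

Section Description.
Context {M : set_structure} {HZF : ZF M}.

Lemma ext (a b : M) : (forall x, x ∈ a <-> x ∈ b) -> a = b.
Proof. exact: ZF_extensionality. Qed.

Lemma inhab : inhabited M.
Proof. by case: (ZF_infinity HZF). Qed.

(** An arbitrary element, used as a default value of environments. *)
Definition c0 : M := sval (cid (let: inhabits x := inhab in ex_intro (fun=> True) x I)).

Lemma empty_ex : exists z : M, is_empty z.
Proof.
have [p [s H]] := D_head (Q := fun _ _ => False) (D_const M False).
have [b Hb] := ZF_separation HZF p (assign s (fun=> c0)) c0.
by exists b => x /Hb [_ /H].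
Qed.

(** [z] is the unique element satisfying [P], or is empty when there is none. *)
Definition the_spec (P : M -> Prop) (z : M) : Prop :=
  (P z /\ forall y, P y -> y = z) \/
  (~ (exists x, P x /\ forall y, P y -> y = x) /\ is_empty z).

Lemma the_ex (P : M -> Prop) : exists z, the_spec P z.
Proof.
case: (pselect (exists x, P x /\ forall y, P y -> y = x)) => [[x Hx]|H].
- by exists x; left.
- by have [z Hz] := empty_ex; exists z; right.
Qed.

(** Definite description: the unique element satisfying [P], or the empty set
    when there is no such element. *)
Definition the (P : M -> Prop) : M := sval (cid (the_ex P)).

Lemma the_specP (P : M -> Prop) z : z = the P <-> the_spec P z.
Proof.
rewrite /the; case: (cid _) => w /= Hw; split=> [->|Hz] //.
case: Hw Hz => [[Hw Uw]|[Hw Ew]] [[Hz Uz]|[Hz Ez]].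
- exact: Uw.
- by case: Hz; exists w.
- by case: Hw; exists z.
- by apply: ext => x; split=> [/Ez|/Ew].
Qed.

Lemma the_eq (P : M -> Prop) z : P z -> (forall y, P y -> y = z) -> the P = z.
Proof. by move=> H U; apply/esym/the_specP; left. Qed.

Lemma the_in (P : M -> Prop) : (exists x, P x /\ forall y, P y -> y = x) -> P (the P).
Proof. by move=> [x [Hx Ux]]; rewrite (the_eq Hx Ux). Qed.

(** If the elements satisfying [Q] form a set, the description of that set denotes
    it. *)
Lemma the_set (Q : M -> Prop) (a : M) : (forall x, x ∈ a <-> Q x) ->
  forall x, x ∈ the (fun a => forall x, x ∈ a <-> Q x) <-> Q x.
Proof.
move=> H; apply: (the_in (P := fun a => forall x, x ∈ a <-> Q x)).
by exists a; split=> // b Hb; apply: ext => x; rewrite H Hb.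
Qed.

(** A description by a definable predicate is a definable term. *)
Lemma DT_the (Q : M -> (nat -> M) -> Prop) :
  D (fun e => Q (e 0) (fun k => e (S k))) -> DT (fun e => the (fun z => Q z e)).
Proof.
move=> HQ.
pose Q' z e := Q z (fun k : nat => e (S k)).
have HQ1 : D (fun e => Q' (e 0) (fun k => e (S k))).
  exact: (D_rename (fun i => if i is 0 then 0 else i.+1) HQ).
have HQ0 : D (fun e => Q' (e 0) e) by exact: HQ.
pose U x e := Q' x e /\ forall y, Q' y e -> y = x.
have HU : D (fun e => U (e 0) (fun k => e (S k))).
  apply: D_and => //; apply: (D_all (Q := fun y e => Q' y (fun k => e (S k)) -> y = e 0)).
  apply: D_imp; last by apply: (D_app2 (D_eq M)); exact: DT_var.
  exact: (D_rename (fun i => if i is 0 then 0 else i.+2) HQ).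
have HU0 : D (fun e => U (e 0) e).
  apply: D_and => //; apply: (D_all (Q := fun y e => Q' y e -> y = e 0)).
  by apply: D_imp => //; apply: (D_app2 (D_eq M)); exact: DT_var.
apply: (D_ext (P := fun e => U (e 0) e \/ (~ (exists x, U x e) /\ is_empty (e 0)))).
- apply: D_or => //; apply: D_and; first exact/D_not/D_ex.
  apply: (D_all (Q := fun y e => ~ y ∈ e 0)); apply: D_not.
  by apply: (D_app2 (D_mem M)); exact: DT_var.
- by move=> e; rewrite the_specP.
Qed.

(** [{x ∈ a | P x}], meaningful for definable [P]. *)
Definition sep (a : M) (P : M -> Prop) : M := the (fun b => forall x, x ∈ b <-> x ∈ a /\ P x).

(** [{F x | x ∈ a}], meaningful for definable [F]. *)
Definition img (a : M) (F : M -> M) : M :=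
  the (fun b => forall y, y ∈ b <-> exists x, x ∈ a /\ y = F x).

Lemma sepE (P : M -> Prop) (a x : M) : D1 P -> x ∈ sep a P <-> x ∈ a /\ P x.
Proof.
move=> /(D_head (Q := fun x _ => P x)) [p [s H]].
have [b Hb] := ZF_separation HZF p (assign s (fun=> c0)) a.
by apply: (the_set (a := b)) => y; rewrite Hb H.
Qed.

Lemma imgE (F : M -> M) (a y : M) : DT1 F -> y ∈ img a F <-> exists x, x ∈ a /\ y = F x.
Proof.
move=> HF; have HF2 : D2 (fun x y => y = F x).
  exact: (D_rename (fun i => if i is 0 then 1 else 0) HF).
have [p [e H]] := D_head2 c0 HF2.
have [|b Hb] := ZF_replacement HZF (p := p) (e := e) (a := a).
  by move=> x y1 y2 _ /H -> /H ->.
apply: (the_set (a := b)) => z; rewrite Hb.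
by split=> -[x [xa Hx]]; exists x; split=> //; apply/H.
Qed.

End Description.

Create HintDb dfn.

#[export] Hint Resolve D_mem D_eq : dfn.

(** [dfn] proves definability by recursion on the syntax of predicates and
    terms, down to the facts recorded in the hint database or assumed. *)
Ltac dfn_side := solve [ assumption | auto 2 with dfn nocore ].
Ltac dfn :=
  cbv beta;
  lazymatch goal with
  | |- D1 _ => first [dfn_side | unfold D1; dfn]
  | |- D2 _ => first [dfn_side | unfold D2; dfn]
  | |- D3 _ => first [dfn_side | unfold D3; dfn]
  | |- DT1 _ => first [dfn_side | unfold DT1; dfn]
  | |- DT2 _ => first [dfn_side | unfold DT2; dfn]
  | |- D (fun _ => ?A) => exact (D_const _ A)
  | |- D (fun e => _ /\ _) => apply D_and; dfn
  | |- D (fun e => _ \/ _) => apply D_or; dfn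
  | |- D (fun e => ~ _) => apply D_not; dfn
  | |- D (fun e => _ <-> _) => apply D_iff; dfn
  | |- D (fun e => ex (unique (@?Q e))) => unfold unique; dfn
  | |- D (fun e => exists x, @?Q e x) => apply (@D_ex _ (fun x e => Q e x)); dfn
  | |- D (fun e => forall x : carrier _, @?Q e x) => apply (@D_all _ (fun x e => Q e x)); dfn
  | |- D (fun e => _ -> _) => apply D_imp; dfn
  | |- D _ => first
    [ lazymatch goal with |- D (fun e => ?P (@?t e)) =>
        apply (@D_app1 _ P t); [dfn_side | dfn] end
    | lazymatch goal with |- D (fun e => ?P (@?t e) (@?u e)) =>
        apply (@D_app2 _ P t u); [dfn_side | dfn | dfn] end
    | lazymatch goal with |- D (fun e => ?P (@?t e) (@?u e) (@?v e)) =>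
        apply (@D_app3 _ P t u v); [dfn_side | dfn | dfn | dfn] end ]
  | |- DT (fun _ => ?c) => exact (DT_const c)
  | |- DT (fun e => e ?i) => exact (DT_var _ i)
  | |- DT (fun e => the (@?Q e)) => apply (@DT_the _ _ (fun x e => Q e x)); dfn
  | |- DT (fun e => sep (@?a e) (@?Q e)) => unfold sep; dfn
  | |- DT (fun e => img (@?a e) (@?Q e)) => unfold img; dfn
  | |- DT _ => first
    [ lazymatch goal with |- DT (fun e => ?F (@?t e)) =>
        apply (@DT_app1 _ F t); [dfn_side | dfn] end
    | lazymatch goal with |- DT (fun e => ?F (@?t e) (@?u e)) =>
        apply (@DT_app2 _ F t u); [dfn_side | dfn | dfn] end ]
  end.

(** Definability of the basic vocabulary. *)
Section Vocabulary.
Context {M : set_structure}.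

Lemma D_is_upair : D3 (@is_upair M). Proof. by unfold is_upair; dfn. Qed.
Hint Resolve D_is_upair : dfn.
Lemma D_is_opair : D3 (@is_opair M). Proof. by unfold is_opair; dfn. Qed.
Hint Resolve D_is_opair : dfn.
Lemma D_subset : D2 (@Defs.subset M). Proof. by unfold Defs.subset; dfn. Qed.
Hint Resolve D_subset : dfn.
Lemma D_is_empty : D1 (@is_empty M). Proof. by unfold is_empty; dfn. Qed.
Hint Resolve D_is_empty : dfn.
Lemma D_is_union : D2 (@is_union M). Proof. by unfold is_union; dfn. Qed.
Lemma D_is_powerset : D2 (@is_powerset M). Proof. by unfold is_powerset; dfn. Qed.
Lemma D_is_succ : D2 (@is_succ M). Proof. by unfold is_succ; dfn. Qed.
Hint Resolve D_is_succ : dfn.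
Lemma D_inductive_set : D1 (@inductive_set M). Proof. by unfold inductive_set; dfn. Qed.
Hint Resolve D_inductive_set : dfn.
Lemma D_is_omega : D1 (@is_omega M). Proof. by unfold is_omega; dfn. Qed.
Hint Resolve D_is_omega : dfn.
Lemma D_related : D3 (@related M). Proof. by unfold related; dfn. Qed.
Hint Resolve D_related : dfn.
Lemma D_is_relation : D3 (@is_relation M). Proof. by unfold is_relation; dfn. Qed.
Hint Resolve D_is_relation : dfn.
Lemma D_is_function : D3 (@is_function M). Proof. by unfold is_function; dfn. Qed.
Hint Resolve D_is_function : dfn.
Lemma D_is_bijection : D3 (@is_bijection M). Proof. by unfold is_bijection; dfn. Qed.
Hint Resolve D_is_bijection : dfn.
Lemma D_countable : D1 (@countable M).
Proof. by unfold countable, equipotent; dfn. Qed.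

End Vocabulary.

#[export] Hint Resolve D_is_upair D_is_opair D_subset D_is_empty D_is_union
  D_is_powerset D_is_succ D_inductive_set D_is_omega D_related D_countable : dfn.

Section Operations.
Context {M : set_structure} {HZF : ZF M}.
Implicit Types (a b c f n m w x y z p : M).

(** The empty set. *)
Definition empt : M := the (@is_empty M).
Definition upair a b : M := the (fun p => is_upair p a b).
(** Kuratowski's ordered pair. *)
Definition op a b : M := the (fun p => is_opair p a b).
(** The union of the members of [a]. *)
Definition bun a : M := the (fun u => is_union u a).
(** The successor [a ∪ {a}]. *)
Definition sc a : M := the (fun s => is_succ s a).
(** The set [ω]. *)
Definition om : M := the (@is_omega M).

Lemma DT_upair : DT2 upair. Proof. by unfold upair; dfn. Qed.
Lemma DT_op : DT2 op. Proof. by unfold op; dfn. Qed.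
Lemma DT_bun : DT1 bun. Proof. by unfold bun; dfn. Qed.
Lemma DT_sc : DT1 sc. Proof. by unfold sc; dfn. Qed.
Hint Resolve DT_upair DT_op DT_bun DT_sc : dfn.

Lemma is_emptyE a : is_empty a <-> a = empt.
Proof.
have He : is_empty empt.
  apply: (the_in (P := @is_empty M)); have [z Hz] := @empty_ex M _.
  by exists z; split=> // y Hy; apply: ext => x; split=> [/Hy|/Hz].
by split=> [Ha|->] //; apply: ext => x; split=> [/Ha|/He].
Qed.

Lemma in_empt x : ~ x ∈ empt.
Proof. by have /is_emptyE H : empt = empt by []; exact: H. Qed.

Lemma upairP a b : is_upair (upair a b) a b.
Proof. by have [p Hp] := ZF_pairing HZF a b; apply: (the_set Hp). Qed.

Lemma is_upairE p a b : is_upair p a b <-> p = upair a b.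
Proof.
split=> [H|->]; last exact: upairP.
by apply: ext => x; rewrite H (upairP a b x).
Qed.

Lemma in_upair x a b : x ∈ upair a b <-> x = a \/ x = b.
Proof. exact: upairP. Qed.

Lemma upair_eq a b c d : upair a b = upair c d -> (a = c /\ b = d) \/ (a = d /\ b = c).
Proof.
move=> E; have H x : x = a \/ x = b <-> x = c \/ x = d by rewrite -!in_upair E.
have [/(_ (or_introl erefl)) Ha _] := H a.
have [/(_ (or_intror erefl)) Hb _] := H b.
have [_ /(_ (or_introl erefl)) Hc] := H c.
have [_ /(_ (or_intror erefl)) Hd] := H d.
by clear H; intuition congruence.
Qed.

Lemma opP a b : is_opair (op a b) a b.
Proof.
apply: (the_set (a := upair (upair a a) (upair a b))
  (Q := fun x => is_upair x a a \/ is_upair x a b)) => x.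
by rewrite in_upair !is_upairE.
Qed.

Lemma is_opairE p a b : is_opair p a b <-> p = op a b.
Proof.
split=> [H|->]; last exact: opP.
by apply: ext => x; rewrite H (opP a b x).
Qed.

Lemma opE a b : op a b = upair (upair a a) (upair a b).
Proof. by apply: ext => x; rewrite (opP a b x) in_upair !is_upairE. Qed.

Lemma op_inj a b c d : op a b = op c d -> a = c /\ b = d.
Proof.
by rewrite !opE => /upair_eq [[/upair_eq ? /upair_eq ?]|[/upair_eq ? /upair_eq ?]]; intuition congruence.
Qed.

Lemma relatedE f x y : related f x y <-> op x y ∈ f.
Proof.
split=> [[p [/is_opairE -> //]]|H].
by exists (op x y); split=> //; apply/is_opairE.
Qed.

Lemma in_bun x a : x ∈ bun a <-> exists y, y ∈ a /\ x ∈ y.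
Proof. by have [u Hu] := ZF_union HZF a; apply: (the_set Hu). Qed.

Lemma is_unionE u a : is_union u a <-> u = bun a.
Proof.
split=> [H|-> x]; last exact: in_bun.
by apply: ext => x; rewrite H in_bun.
Qed.

Lemma in_sc x a : x ∈ sc a <-> x ∈ a \/ x = a.
Proof.
apply: (the_set (a := bun (upair a (upair a a)))) => y; rewrite in_bun; split.
- by move=> [z [/in_upair [->|-> /in_upair]]]; tauto.
- case=> H; [exists a|exists (upair a a)]; rewrite !in_upair; tauto.
Qed.

Lemma is_succE s a : is_succ s a <-> s = sc a.
Proof.
split=> [H|-> x]; last exact: in_sc.
by apply: ext => x; rewrite H in_sc.
Qed.

(** Cartesian product. *)
Definition prd a b : M := bun (img a (fun x => img b (fun y => op x y))).

Lemma DT_prd : DT2 prd. Proof. by unfold prd; dfn. Qed.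

Lemma in_prd z a b : z ∈ prd a b <-> exists x y, x ∈ a /\ y ∈ b /\ z = op x y.
Proof.
rewrite in_bun; split.
- move=> [c []]; rewrite imgE; last by dfn.
  move=> [x [xa ->]]; rewrite imgE; last by dfn.
  by move=> [y [yb ->]]; exists x, y.
- move=> [x [y [xa [yb ->]]]]; exists (img b (fun y => op x y)).
  rewrite !imgE; [|dfn..]; split; [by exists x|by exists y].
Qed.

Lemma op_in_prd x y a b : op x y ∈ prd a b <-> x ∈ a /\ y ∈ b.
Proof.
rewrite in_prd; split=> [[x' [y' [? [? /op_inj [-> ->]]]]] //|[? ?]].
by exists x, y.
Qed.

Lemma is_prodE p a b : is_prod p a b <-> p = prd a b.
Proof.
have H z : (exists x y, x ∈ a /\ y ∈ b /\ is_opair z x y) <-> z ∈ prd a b.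
  by rewrite in_prd; split=> -[x [y [? [? /is_opairE ?]]]]; exists x, y.
split=> [K|-> z]; last by rewrite H.
by apply: ext => z; rewrite K H.
Qed.

(** ** The natural numbers *)

Lemma inductiveE a : inductive_set a <-> empt ∈ a /\ forall x, x ∈ a -> sc x ∈ a.
Proof.
split.
- move=> [[e [/is_emptyE -> ?]] H]; split=> // x /H [s [/is_succE ->]] //.
- move=> [H0 H]; split; first by exists empt; split=> //; apply/is_emptyE.
  by move=> x /H; exists (sc x); split=> //; apply/is_succE.
Qed.

Lemma omP : is_omega om.
Proof.
apply: (the_in (P := @is_omega M)).
have [a /[dup] Ha /inductiveE [H0 HS]] := ZF_infinity HZF.
pose (w := sep a (fun x => forall b, inductive_set b -> x ∈ b)).
have Hw x : x ∈ w <-> x ∈ a /\ forall b, inductive_set b -> x ∈ b.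
  by apply: sepE; dfn.
exists w; split.
- split; last by move=> b Hb x /Hw [_]; exact.
  apply/inductiveE; split; first by apply/Hw; split=> // b /inductiveE [].
  move=> x /Hw [xa Hx]; apply/Hw; split; first exact: HS.
  by move=> b Hb; have /inductiveE [_] := Hb; apply; apply: Hx.
- move=> v [Iv Lv]; apply: ext => x; rewrite Hw; split.
  + by move=> xv; split=> [|b Hb]; apply: (Lv _ _ x xv).
  + by move=> [_]; exact.
Qed.

Lemma om0 : empt ∈ om.
Proof. by have [/inductiveE []] := omP. Qed.

Lemma omS n : n ∈ om -> sc n ∈ om.
Proof. by have [/inductiveE [_ H] _] := omP; exact: H. Qed.

Lemma is_omegaE w : is_omega w <-> w = om.
Proof.
split=> [[Iw Lw]|->]; last exact: omP.
have [Io Lo] := omP; apply: ext => x; split; [exact: Lw|exact: Lo].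
Qed.

(** Induction over [ω], for definable predicates. *)
Lemma om_ind (P : M -> Prop) : D1 P -> P empt ->
  (forall n, n ∈ om -> P n -> P (sc n)) -> forall n, n ∈ om -> P n.
Proof.
move=> HP P0 PS n Hn.
apply: (proj2 (iffLR (sepE om n HP) _)).
have [_ Lo] := omP; apply: Lo Hn; apply/inductiveE; split.
- by apply/(sepE _ _ HP); split=> //; exact: om0.
- by move=> x /(sepE _ _ HP) [? ?]; apply/(sepE _ _ HP); split; [exact: omS|exact: PS].
Qed.

Lemma om_trans n m : n ∈ om -> m ∈ n -> m ∈ om.
Proof.
move=> Hn; move: n Hn m.
apply: om_ind; first by dfn.
- by move=> m /in_empt.
- by move=> n Hn IH m /in_sc [/IH|->].
Qed.

Lemma om_mem_trans n m k : n ∈ om -> k ∈ m -> m ∈ n -> k ∈ n.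
Proof.
move=> Hn; move: n Hn m k.
apply: om_ind; first by dfn.
- by move=> m k _ /in_empt.
- move=> n Hn IH m k km /in_sc [mn|mn]; apply/in_sc; left; first exact: IH mn.
  by rewrite -mn.
Qed.

Lemma mem_irrefl a : ~ a ∈ a.
Proof.
move=> aa; have [|x [/in_upair xa H]] := ZF_foundation HZF (a := upair a a).
  by exists a; apply/in_upair; left.
have E : x = a by case: xa.
by subst x; apply: (H a aa); apply/in_upair; left.
Qed.

Lemma sc_neq0 n : sc n <> empt.
Proof. by move=> E; apply: (@in_empt n); rewrite -E in_sc; right. Qed.

Lemma sc_inj n m : n ∈ om -> m ∈ om -> sc n = sc m -> n = m.
Proof.
move=> Hn Hm E.
have /in_sc [nm|//] : n ∈ sc m by rewrite -E in_sc; right.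
have /in_sc [mn|//] : m ∈ sc n by rewrite E in_sc; right.
by case: (@mem_irrefl n); apply: om_mem_trans nm mn.
Qed.

Lemma om_case n : n ∈ om -> n = empt \/ exists m, m ∈ om /\ n = sc m.
Proof.
move: n; apply: om_ind; first by dfn.
- by left.
- by move=> n Hn _; right; exists n.
Qed.

Lemma om0_mem n : n ∈ om -> empt ∈ sc n.
Proof.
move: n; apply: om_ind; first by dfn.
- by apply/in_sc; right.
- by move=> n Hn IH; apply/in_sc; left.
Qed.

Lemma om_sc_mem n m : n ∈ om -> m ∈ n -> sc m ∈ sc n.
Proof.
move=> Hn; move: n Hn m; apply: om_ind; first by dfn.
- by move=> m /in_empt.
- move=> n Hn IH m /in_sc [/IH|->]; last by apply/in_sc; right.
  by move=> H; apply/in_sc; left.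
Qed.

Lemma om_total n m : n ∈ om -> m ∈ om -> n ∈ m \/ n = m \/ m ∈ n.
Proof.
move=> Hn; move: n Hn m; apply: om_ind; first by dfn.
- by move=> m /om0_mem /in_sc [|]; tauto.
- move=> n Hn IH m Hm; case: (IH m Hm) => [nm|[<-|mn]].
  + case/in_sc: (om_sc_mem Hm nm); tauto.
  + by right; right; apply/in_sc; right.
  + by right; right; apply/in_sc; left.
Qed.

(** [n] is the least natural number satisfying [P]. *)
Definition is_least (P : M -> Prop) n : Prop :=
  n ∈ om /\ P n /\ forall m, m ∈ n -> ~ P m.

(** By foundation, a definable non-empty class of natural numbers has a least
    element. *)
Lemma least_ex (P : M -> Prop) : D1 P -> (exists n, n ∈ om /\ P n) -> exists n, is_least P n.
Proof.
move=> HP [n [Hn Pn]].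
(* An ∈-minimal element of the class is its least element. *)
have [|m [/(sepE _ _ HP) [Hm Pm] H]] := ZF_foundation HZF (a := sep om P).
  by exists n; apply/(sepE _ _ HP).
exists m; split=> //; split=> // k km Pk; apply: (H k km).
by apply/(sepE _ _ HP); split=> //; apply: om_trans km.
Qed.

Lemma least_uniq (P : M -> Prop) n m : is_least P n -> is_least P m -> n = m.
Proof.
move=> [Hn [Pn Ln]] [Hm [Pm Lm]].
by case: (om_total Hn Hm) => [/Lm|[|/Ln]].
Qed.

(** ** Recursion *)

Section Recursion.
Variables (A z0 : M) (H : M -> M).
Hypotheses (HD : DT1 H) (z0A : z0 ∈ A) (HA : forall x, x ∈ A -> H x ∈ A).

(** [r] contains [(0, z0)] and is closed under [(n, x) => (n + 1, H x)]. *)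
Definition rec_closed r : Prop :=
  op empt z0 ∈ r /\
  forall n x, n ∈ om -> op n x ∈ r -> op (sc n) (H x) ∈ r.

(** The smallest such relation. *)
Definition rec_graph n x : Prop := forall r, rec_closed r -> op n x ∈ r.

(** The sequence with [recf 0 = z0] and [recf (n + 1) = H (recf n)]. *)
Definition recf n : M := the (rec_graph n).

Lemma DT_recf : DT1 recf.
Proof. by unfold recf, rec_graph, rec_closed; dfn. Qed.

Lemma rec_graphS n x : n ∈ om -> rec_graph n x -> rec_graph (sc n) (H x).
Proof. by move=> Hn G r Hr; apply: (proj2 Hr) => //; apply: G. Qed.

(* A pair that is not forced by the closure conditions can be removed from a
   closed set, so it is not in the smallest closed relation. *)
Lemma rec_graph_remove n x : rec_graph n x -> op n x <> op empt z0 ->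
  exists m y, m ∈ om /\ rec_graph m y /\ op n x = op (sc m) (H y).
Proof.
move=> G N0; apply: contrapT => N.
have C0 : rec_closed (prd om A).
  split; first by apply/op_in_prd; split=> //; exact: om0.
  by move=> m y Hm /op_in_prd [_ /HA yA]; apply/op_in_prd; split=> //; apply: omS.
pose Q := fun p => p <> op n x /\ forall r, rec_closed r -> p ∈ r.
have DQ : D1 Q by unfold Q, rec_closed; dfn.
apply: (proj1 (proj2 (iffLR (sepE (prd om A) (op n x) DQ) _))) => //.
apply: G; split.
- apply/(sepE _ _ DQ); split; first by apply: (proj1 C0).
  by split; [exact/nesym|move=> r []].
- move=> m y Hm /(sepE _ _ DQ) [yA [ynx Gy]].
  apply/(sepE _ _ DQ); split; first exact: (proj2 C0).
  split; last by move=> r Hr; apply: (proj2 Hr) => //; apply: Gy.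
  by move=> E; apply: N; exists m, y.
Qed.

Lemma rec_graph_ex n : n ∈ om -> exists x, rec_graph n x /\ forall y, rec_graph n y -> y = x.
Proof.
move: n; apply: om_ind; first by unfold rec_graph, rec_closed; dfn.
- exists z0; split=> [r []|y Gy] //; apply: contrapT => N.
  have [/op_inj [_ /N]|m [x [_ [_ /op_inj [/esym /sc_neq0]]]]] // := rec_graph_remove Gy.
- move=> n Hn [x [Gx Ux]]; exists (H x); split; first exact: rec_graphS.
  move=> y Gy; have [/op_inj [/sc_neq0]|m [z [Hm [Gz /op_inj [E ->]]]]] // := rec_graph_remove Gy.
  by rewrite -(Ux z) //; rewrite (sc_inj Hn Hm E).
Qed.

Lemma recfP n : n ∈ om -> rec_graph n (recf n).
Proof. by move=> Hn; apply: the_in; apply: rec_graph_ex. Qed.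

Lemma recf0 : recf empt = z0.
Proof.
have [x [_ Ux]] := rec_graph_ex om0.
by rewrite (Ux _ (recfP om0)); symmetry; apply: Ux => r [].
Qed.

Lemma recfS n : n ∈ om -> recf (sc n) = H (recf n).
Proof.
move=> Hn; have [x [_ Ux]] := rec_graph_ex (omS Hn).
by rewrite (Ux _ (recfP (omS Hn))); symmetry; apply/Ux/rec_graphS/recfP.
Qed.

Lemma recf_in n : n ∈ om -> recf n ∈ A.
Proof.
have DR := DT_recf.
move: n; apply: om_ind; first by dfn.
- by rewrite recf0.
- by move=> n Hn /HA; rewrite recfS.
Qed.

End Recursion.

End Operations.

#[export] Hint Resolve DT_upair DT_op DT_bun DT_sc DT_prd : dfn.

(** * Countability *)

Section Countability.
Context {M : set_structure} {HZF : ZF M}.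
Implicit Types (a b c f n m w x y z p : M).

Lemma sc_mem_sc k m : m ∈ om -> sc k ∈ sc m -> k ∈ m.
Proof.
move=> Hm /in_sc [H|<-]; last by apply/in_sc; right.
by apply: om_mem_trans H => //; apply/in_sc; right.
Qed.

(** One step of the walk through [ω × ω] that visits, for each [m], the pairs
    [(m, 0), ..., (m, m)] and then [(0, m + 1), ..., (m, m + 1)]. *)
Definition walk_rel p q : Prop := exists a b, p = op a b /\
  ((b ∈ a /\ q = op a (sc b)) \/ (a = b /\ q = op empt (sc b)) \/
   (sc a = b /\ q = op b empt) \/ (a ∈ b /\ sc a <> b /\ q = op (sc a) b)).

Definition walk_step p : M := the (walk_rel p).

(** The pair visited at time [n], starting from [(0, 0)]. *)
Definition walk n : M := recf (op empt empt) walk_step n.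

Lemma DT_walk_step : DT1 walk_step.
Proof. by unfold walk_step, walk_rel; dfn. Qed.
Hint Resolve DT_walk_step : dfn.

Lemma DT_walk : DT1 walk.
Proof. by apply: DT_recf; dfn. Qed.
Hint Resolve DT_walk : dfn.

(** The four cases of [walk_rel] exclude each other on [ω], so the step is well
    defined. *)
Lemma walk_stepE a b q : a ∈ om -> b ∈ om -> walk_rel (op a b) q -> walk_step (op a b) = q.
Proof.
move=> Ha Hb Hq; apply: the_eq => // r [a' [b' [/op_inj [<- <-] {a' b'}]]].
case: Hq => a' [b' [/op_inj [<- <-] {a' b'}]].
have aa x : ~ x ∈ x := @mem_irrefl M HZF x.
have sa : a ∈ sc a by apply/in_sc; right.
have ab : ~ (b ∈ a /\ a ∈ b).
  by move=> [ba]; move=> /(om_mem_trans Hb ba); apply: aa.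
case=> [[H ->]|[[H ->]|[[H ->]|[H [H' ->]]]]];
case=> [[K ->]|[[K ->]|[[K ->]|[K [K' ->]]]]] //; subst; try by [case: (aa _ H)|case: (aa _ K)|case: ab].
- by move: sa; rewrite K => /aa.
- by move: sa; rewrite -K => /aa.
Qed.

(** The pair [p] is reached by the walk. *)
Definition visited p : Prop := exists n, n ∈ om /\ walk n = p.

Lemma walk_step_in p : p ∈ prd om om -> walk_step p ∈ prd om om.
Proof.
move=> /in_prd [a [b [Ha [Hb ->]]]].
have [q [Hq qin]] : exists q, walk_rel (op a b) q /\ q ∈ prd om om; last first.
  by rewrite (walk_stepE Ha Hb Hq).
have H0 := @om0 M HZF; have Sa := omS Ha; have Sb := omS Hb.
case: (om_total Ha Hb) => [ab|[ab|ba]].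
- case: (pselect (sc a = b)) => E.
  + exists (op b empt); split; last by apply/op_in_prd.
    by exists a, b; split=> //; right; right; left.
  + exists (op (sc a) b); split; last by apply/op_in_prd.
    by exists a, b; split=> //; right; right; right.
- exists (op empt (sc b)); split; last by apply/op_in_prd.
  by exists a, b; split=> //; right; left.
- exists (op a (sc b)); split; last by apply/op_in_prd.
  by exists a, b; split=> //; left.
Qed.

Lemma walk00_in : op empt empt ∈ prd (@om M HZF) om.
Proof. by apply/op_in_prd; split; exact: om0. Qed.

Lemma visited_step a b q : a ∈ om -> b ∈ om -> visited (op a b) ->
  walk_rel (op a b) q -> visited q.
Proof.
move=> Ha Hb [n [Hn E]] Hq; exists (sc n); split; first exact: omS.
have := recfS DT_walk_step walk00_in walk_step_in Hn.
by rewrite /walk => ->; rewrite -(walk_stepE Ha Hb Hq) -E.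
Qed.

Lemma visited_row m : m ∈ om -> visited (op m empt) ->
  forall k, k ∈ om -> k ∈ sc m -> visited (op m k).
Proof.
move=> Hm V0; apply: om_ind; first by unfold visited; dfn.
- by [].
- move=> k Hk IH /(sc_mem_sc Hm) km.
  apply: (visited_step Hm Hk); first by apply/IH/in_sc; left.
  by exists m, k; split=> //; left.
Qed.

Lemma visited_column m : m ∈ om -> visited (op m empt) ->
  forall k, k ∈ om -> k ∈ sc m -> visited (op k (sc m)).
Proof.
move=> Hm V0; apply: om_ind; first by unfold visited; dfn.
- move=> _; apply: (visited_step Hm Hm); first by apply: visited_row => //; apply/in_sc; right.
  by exists m, m; split=> //; right; left.
- move=> k Hk IH /(sc_mem_sc Hm) km.
  have ksm : k ∈ sc m by apply/in_sc; left.
  apply: (visited_step Hk (omS Hm) (IH ksm)).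
  exists k, (sc m); split=> //; right; right; right; split=> //; split=> //.
  by move=> /(sc_inj Hk Hm) E; apply: (@mem_irrefl M HZF k); rewrite {2}E.
Qed.

Lemma visited_corner m : m ∈ om -> visited (op m empt).
Proof.
move: m; apply: om_ind; first by unfold visited; dfn.
- exists empt; split; first exact: om0.
  exact: (recf0 DT_walk_step walk00_in walk_step_in).
- move=> m Hm IH; have mm : m ∈ sc m by apply/in_sc; right.
  apply: (visited_step Hm (omS Hm) (visited_column Hm IH Hm mm)).
  by exists m, (sc m); split=> //; right; right; left.
Qed.

Lemma walk_surj a b : a ∈ om -> b ∈ om -> exists n, n ∈ om /\ walk n = op a b.
Proof.
move=> Ha Hb.
have row : b ∈ sc a -> visited (op a b).
  by apply: visited_row => //; exact: visited_corner.
case: (om_total Ha Hb) => [ab|[ab|ba]].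
- case: (om_case Hb) ab => [->|[m [Hm ->]]] ab; first by case: (in_empt ab).
  exact: (visited_column Hm (visited_corner Hm) Ha ab).
- by apply/row/in_sc; right.
- by apply/row/in_sc; left.
Qed.

(** A set with a definable injection into [ω]. *)
Definition cnt a : Prop := exists F : M -> M, DT1 F /\
  (forall x, x ∈ a -> F x ∈ om) /\
  (forall x y, x ∈ a -> y ∈ a -> F x = F y -> x = y).

(** A definable injection is the graph of a bijection onto its image. *)
Lemma equipotent_img a (F : M -> M) : DT1 F ->
  (forall x y, x ∈ a -> y ∈ a -> F x = F y -> x = y) -> equipotent a (img a F).
Proof.
move=> DF inj; pose (f := img a (fun x => op x (F x))).
have inf x y : op x y ∈ f <-> x ∈ a /\ y = F x.
  rewrite imgE; last by dfn.
  by split=> [[x' [? /op_inj [-> ->]]]|[? ->]] //; exists x.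
have ina y : y ∈ img a F <-> exists x, x ∈ a /\ y = F x by rewrite imgE.
exists f; split; first split.
- move=> p; rewrite imgE; last by dfn.
  move=> [x [xa ->]]; exists x, (F x); split=> //; split; first by apply/ina; exists x.
  exact: opP.
- move=> x xa; exists (F x); split.
  + by split; [apply/ina; exists x|apply/relatedE/inf].
  + by move=> y [_ /relatedE /inf []].
- move=> y /ina [x [xa ->]]; exists x; split; first by split=> //; apply/relatedE/inf.
  by move=> x' [x'a /relatedE /inf [_ E]]; apply: inj.
Qed.

Lemma countableE a : countable a <-> cnt a.
Proof.
split.
- move=> [w [s [/is_omegaE -> [sw [f [[rel fn] inv]]]]]].
  pose (F := fun x => the (fun y => y ∈ s /\ related f x y)).
  have FP x : x ∈ a -> F x ∈ s /\ related f x (F x).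
    move=> /fn [y [Hy Uy]]; apply: (the_in (P := fun y => y ∈ s /\ related f x y)).
    by exists y; split=> // z /Uy.
  exists F; split; first by unfold F; dfn.
  split; first by move=> x /FP [/sw].
  move=> x y xa ya E; have [Fs Rx] := FP x xa; have [_ Ry] := FP y ya.
  have [z [_ Uz]] := inv _ Fs.
  by rewrite -(Uz x) // -(Uz y) // E.
- move=> [F [DF [Fom inj]]]; exists om, (img a F).
  split; first exact: omP.
  split; last exact: equipotent_img.
  by move=> y; rewrite imgE // => -[x [/Fom ? ->]].
Qed.

Lemma D_cnt : D1 cnt.
Proof. by apply: (D_ext (D_countable (M := M))) => e; apply: countableE. Qed.

(** A set is countable when its elements have definable names in [ω]: the least
    name gives an injection, without any choice. *)
Lemma cnt_names c (N : M -> M -> Prop) : D2 N ->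
  (forall z, z ∈ c -> exists n, n ∈ om /\ N n z) ->
  (forall n z z', z ∈ c -> z' ∈ c -> N n z -> N n z' -> z = z') -> cnt c.
Proof.
move=> DN ex un; pose (F := fun z => the (fun n => is_least (fun k => N k z) n)).
have FP z : z ∈ c -> is_least (fun k => N k z) (F z).
  move=> /ex H; apply: the_in; have [|n Hn] := least_ex (P := fun k => N k z) _ H.
    by dfn.
  by exists n; split=> // m Hm; apply: least_uniq Hm Hn.
exists F; split; first by unfold F, is_least; dfn.
split; first by move=> z /FP [].
move=> x y xc yc E; have [_ [Nx _]] := FP x xc; have [_ [Ny _]] := FP y yc.
by apply: (un (F x)) => //; rewrite E.
Qed.

(** The image of a product of countable sets is countable. *)
Lemma cnt_img2 a b c (G : M -> M -> M) : DT2 G -> cnt a -> cnt b ->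
  (forall z, z ∈ c -> exists x y, x ∈ a /\ y ∈ b /\ z = G x y) -> cnt c.
Proof.
move=> DG [F [DF [Fom Finj]]] [F' [DF' [F'om F'inj]]] H.
apply: (cnt_names (N := fun n z =>
  exists x y, x ∈ a /\ y ∈ b /\ z = G x y /\ walk n = op (F x) (F' y))).
- by dfn.
- move=> z /H [x [y [xa [yb ->]]]].
  have [n [Hn E]] := walk_surj (Fom x xa) (F'om y yb).
  by exists n; split=> //; exists x, y.
- move=> n z z' _ _ [x [y [xa [yb [-> E]]]]] [x' [y' [xa' [yb' [-> E']]]]].
  by move: E; rewrite E' => /op_inj [/Finj <- // /F'inj <-].
Qed.

Lemma cnt_img a c (G : M -> M) : DT1 G -> cnt a ->
  (forall z, z ∈ c -> exists x, x ∈ a /\ z = G x) -> cnt c.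
Proof.
move=> DG Ha H; apply: (cnt_img2 (G := fun x _ => G x) _ Ha Ha); first by dfn.
by move=> z /H [x [xa ->]]; exists x, x.
Qed.

Lemma cnt_sub a b : cnt b -> a ⊆ b -> cnt a.
Proof. by move=> [F [DF [Fom Finj]]] ab; exists F; split=> //; split; eauto. Qed.

Lemma finite_cnt a : finite a -> cnt a.
Proof.
move=> [w [n [/is_omegaE -> [Hn E]]]]; apply/countableE; exists om, n.
by split; [exact: omP|split=> // x; apply: om_trans].
Qed.

Lemma finite_sing a : finite (upair a a).
Proof.
exists om, (sc empt); split; first exact: omP; split; first exact/omS/om0.
have -> : sc empt = img (upair a a) (fun=> empt).
  apply: ext => x; rewrite imgE ?in_sc; last by dfn.
  split=> [[/in_empt|->] //|[y [_ ->]]]; last by right.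
  by exists a; split=> //; apply/in_upair; left.
apply: equipotent_img; first by dfn.
by move=> x y /in_upair Hx /in_upair Hy _; case: Hx; case: Hy => -> ->.
Qed.

Lemma CUC_bun : CUC M -> forall F, cnt F -> (forall a, a ∈ F -> cnt a) -> cnt (bun F).
Proof.
move=> H F HF Ha; apply/countableE; apply: (H F); first exact/countableE.
- by move=> a /Ha /countableE.
- exact/is_unionE.
Qed.

End Countability.

#[export] Hint Resolve DT_walk D_cnt : dfn.

(** * Condensation points and countable unions *)

Section Condensation.
Context {M : set_structure} {HZF : ZF M}.
Implicit Types (a b c f n m w x y z p A B F T U V X : M).

(** Binary intersection and power set. *)
Definition cap a b : M := sep a (fun x => x ∈ b).
Definition pow a : M := the (fun p => is_powerset p a).

Lemma DT_cap : DT2 cap. Proof. by unfold cap; dfn. Qed.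
Hint Resolve DT_cap : dfn.

Lemma in_cap x a b : x ∈ cap a b <-> x ∈ a /\ x ∈ b.
Proof. by apply: sepE; dfn. Qed.

Lemma is_interE i a b : is_inter i a b <-> i = cap a b.
Proof.
split=> [H|-> x]; last exact: in_cap.
by apply: ext => x; rewrite H in_cap.
Qed.

Lemma in_pow x a : x ∈ pow a <-> x ⊆ a.
Proof. by have [p Hp] := ZF_powerset HZF a; apply: (the_set Hp). Qed.

(** A base gives a neighbourhood base at each point, and conversely. *)
Lemma is_baseE B T : is_base B T <-> B ⊆ T /\
  forall U x, U ∈ T -> x ∈ U -> exists V, V ∈ B /\ x ∈ V /\ V ⊆ U.
Proof.
split=> -[BT H]; split=> //.
- move=> U x /H [F [FB UF]] /UF [V [VF xV]]; exists V; split; first exact: FB.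
  by split=> // y yV; apply/UF; exists V.
- move=> U UT; exists (sep B (fun V => V ⊆ U)).
  have HV V : V ∈ sep B (fun V => V ⊆ U) <-> V ∈ B /\ V ⊆ U by apply: sepE; dfn.
  split; first by move=> V /HV [].
  move=> x; split; last by move=> [V [/HV [_ VU] /VU]].
  by move=> /(H U x UT) [V [VB [xV VU]]]; exists V; split=> //; apply/HV.
Qed.

(** No point of [A] condenses iff each has a neighbourhood with countable trace
    on [A]. *)
Lemma no_condensation X T A : A ⊆ X ->
  ~ (exists x, x ∈ A /\ condensation_point X T A x) <->
  forall x, x ∈ A -> exists U, U ∈ T /\ x ∈ U /\ cnt (cap A U).
Proof.
move=> AX; split.
- move=> N x xA; apply: contrapT => K; apply: N; exists x; split=> //; split; first exact: AX.
  move=> U UT xU; exists (cap A U); split; first exact/is_interE.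
  by move=> /countableE C; apply: K; exists U.
- move=> H [x [xA [_ C]]]; have [U [UT [xU CU]]] := H x xA.
  by have [I [/is_interE -> ]] := C U UT xU; apply; apply/countableE.
Qed.

Lemma CUC_cuf a : CUC M -> cuf a -> cnt a.
Proof.
move=> H [F [/countableE HF [Hf /is_unionE ->]]]; apply: CUC_bun => // b /Hf.
exact: finite_cnt.
Qed.

(** If no point of [A] condenses, then [A] is covered by the countable traces on
    [A] of the members of a countable base. *)
Lemma CUC_condensation : CUC M -> cuf_base_condensation M.
Proof.
move=> H X T _ [B [/is_baseE [BT HB] /(CUC_cuf H) CB]] A AX UA.
apply: contrapT => /(no_condensation _ AX) N; apply/UA/countableE.
pose (S := sep B (fun V => cnt (cap A V))).
have HS V : V ∈ S <-> V ∈ B /\ cnt (cap A V) by apply: sepE; dfn.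
pose (W := img S (fun V => cap A V)).
have HW Z : Z ∈ W <-> exists V, V ∈ S /\ Z = cap A V by apply: imgE; dfn.
apply: (cnt_sub (b := bun W)).
- apply: (CUC_bun H).
  + apply: (cnt_img (a := S) (G := fun V => cap A V)); first by dfn.
    * by apply: (cnt_sub CB) => V /HS [].
    * by move=> Z /HW.
  + by move=> Z /HW [V [/HS [_ ?] ->]].
- move=> x xA; have [U [UT [xU CU]]] := N x xA.
  have [V [VB [xV VU]]] := HB U x UT xU.
  apply/in_bun; exists (cap A V); split; last exact/in_cap.
  apply/HW; exists V; split=> //; apply/HS; split=> //.
  by apply: (cnt_sub CU) => y /in_cap [? /VU ?]; apply/in_cap.
Qed.

(** A countable set is the union of its singletons. *)
Lemma second_countable_cuf T : second_countable T -> has_cuf_base T.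
Proof.
move=> [B [HB /countableE CB]]; exists B; split=> //.
have HS Z : Z ∈ img B (fun b => upair b b) <-> exists b, b ∈ B /\ Z = upair b b.
  by apply: imgE; dfn.
exists (img B (fun b => upair b b)); split; last split.
- apply/countableE; apply: (cnt_img (a := B) (G := fun b => upair b b)) => //; first by dfn.
  by move=> Z /HS.
- by move=> Z /HS [b [_ ->]]; exact: finite_sing.
- move=> x; split.
  + move=> xB; exists (upair x x); split; first by apply/HS; exists x.
    by apply/in_upair; left.
  + by move=> [Z [/HS [b [bB ->]]] /in_upair []] ->.
Qed.

Lemma cuf_second_condensation :
  cuf_base_condensation M -> second_countable_condensation M.
Proof. by move=> H X T HT /second_countable_cuf; apply: H. Qed.

Section Fibres.
(* [J] numbers the members of [F]. *)
Variables (F : M) (J : M -> M).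
Hypotheses (DJ : DT1 J) (Jom : forall a, a ∈ F -> J a ∈ om)
  (Jinj : forall a b, a ∈ F -> b ∈ F -> J a = J b -> a = b).

(** The member of [F] with least number among those containing [x]. *)
Definition owner_rel x a : Prop :=
  a ∈ F /\ x ∈ a /\ forall b, b ∈ F -> x ∈ b -> ~ J b ∈ J a.
Definition owner x : M := the (owner_rel x).

Lemma DT_owner : DT1 owner. Proof. by unfold owner, owner_rel; dfn. Qed.
Hint Resolve DT_owner : dfn.

Lemma ownerP x : x ∈ bun F -> owner_rel x (owner x).
Proof.
move=> /in_bun [a0 [a0F xa0]]; apply: the_in.
have [||n [Hn [[a [aF [xa E]]] L]]] :=
  least_ex (P := fun n => exists a, a ∈ F /\ x ∈ a /\ n = J a).
- by dfn.
- by exists (J a0); split; [exact: Jom|exists a0].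
exists a; split.
- by split=> //; split=> // b bF xb; rewrite -E => /L; apply; exists b.
- move=> b [bF [xb Lb]]; apply: Jinj => //.
  case: (om_total (Jom bF) Hn) => [|[->|]] //.
  + by move=> /L []; exists b.
  + by rewrite E => /Lb; case.
Qed.

(** The points whose owner is [a]. *)
Definition fibre a : M := sep (bun F) (fun x => owner x = a).

Lemma DT_fibre : DT1 fibre. Proof. by unfold fibre; dfn. Qed.
Hint Resolve DT_fibre : dfn.

Lemma in_fibre x a : x ∈ fibre a <-> x ∈ bun F /\ owner x = a.
Proof. by apply: sepE; dfn. Qed.

(** The partition topology whose open sets are the unions of fibres. *)
Definition fibre_topology : M := sep (pow (bun F)) (fun U =>
  forall x y, x ∈ U -> y ∈ bun F -> owner x = owner y -> y ∈ U).

Lemma DT_pow : DT1 pow. Proof. by unfold pow; dfn. Qed.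
Hint Resolve DT_pow : dfn.

Lemma in_fibre_topology U : U ∈ fibre_topology <-> U ⊆ bun F /\
  forall x y, x ∈ U -> y ∈ bun F -> owner x = owner y -> y ∈ U.
Proof. by rewrite -in_pow; apply: sepE; dfn. Qed.

Lemma fibre_space : topological_space (bun F) fibre_topology.
Proof.
split.
- by move=> U /in_fibre_topology [].
- by move=> U HU; apply/in_fibre_topology; split=> [x /HU|x y /HU].
- by apply/in_fibre_topology; split.
- move=> U V W /in_fibre_topology [UF HU] /in_fibre_topology [VF HV] HW.
  apply/in_fibre_topology; split=> [x /HW [/UF]|x y /HW [xU xV] yF E] //.
  by apply/HW; split; [apply: (HU x)|apply: (HV x)].
- move=> G U GT UG; apply/in_fibre_topology; split=> [x /UG|x y /UG].
  + by move=> [V [/GT /in_fibre_topology [VF _] /VF]].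
  + move=> [V [VG xV]] yF E; apply/UG; exists V; split=> //.
    by have /in_fibre_topology [_ HV] := GT V VG; apply: (HV x).
Qed.

Lemma fibre_second_countable : second_countable fibre_topology.
Proof.
have HB Z : Z ∈ img F fibre <-> exists a, a ∈ F /\ Z = fibre a.
  by apply: imgE; dfn.
exists (img F fibre); split; first (apply/is_baseE; split).
- move=> Z /HB [a [aF ->]]; apply/in_fibre_topology; split=> [x /in_fibre []|] //.
  by move=> x y /in_fibre [_ <-] yF E; apply/in_fibre.
- move=> U x /in_fibre_topology [UF HU] xU; exists (fibre (owner x)).
  have xF := UF x xU; have [oF _] := ownerP xF.
  split; first by apply/HB; exists (owner x).
  split; first exact/in_fibre.
  by move=> y /in_fibre [yF E]; apply: (HU x).
- apply/countableE; apply: (cnt_img (a := F) (G := fibre)); first by dfn.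
  + by exists J.
  + by move=> Z /HB.
Qed.

End Fibres.

Lemma second_condensation_CUC : second_countable_condensation M -> CUC M.
Proof.
move=> H F u /countableE [J [DJ [Jom Jinj]]] CF /is_unionE ->.
apply: contrapT => U.
have [|x [xu [_ C]]] := H _ _ (fibre_space F DJ) (fibre_second_countable DJ Jom Jinj) (bun F) _ U.
  by [].
have [oF [_ _]] := ownerP DJ Jom Jinj xu.
have [||I [/is_interE -> ]] := C (fibre F J (owner F J x)).
- apply/(in_fibre_topology F DJ _); split=> [y /(in_fibre F DJ _ _) []|] //.
  by move=> y z /(in_fibre F DJ _ _) [_ <-] zF E; apply/(in_fibre F DJ _ _).
- exact/(in_fibre F DJ _ _).
apply; apply/countableE; have /countableE Co := CF _ oF; apply: (cnt_sub Co) => y.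
move=> /in_cap [_ /(in_fibre F DJ _ _) [yF <-]].
by have [_ []] := ownerP DJ Jom Jinj yF.
Qed.

End Condensation.

#[export] Hint Resolve DT_cap : dfn.

(** * The real numbers of a model as an ordered field *)

Section BinaryOperation.
Context {M : set_structure} {HZF : ZF M}.

(** The value of the binary operation [o] at [(x, y)]. *)
Definition opv (o x y : M) : M := the (fun z => op_value o x y z).

Lemma DT_opv o : DT2 (opv o).
Proof. by unfold opv, op_value; dfn. Qed.

Lemma op_valueE (o x y z : M) : op_value o x y z <-> op (op x y) z ∈ o.
Proof.
split=> [[p [/is_opairE -> /relatedE]] //|H].
by exists (op x y); split; [exact/is_opairE|exact/relatedE].
Qed.

Lemma opvP (o R x y : M) : binary_operation o R -> x ∈ R -> y ∈ R ->
  opv o x y ∈ R /\ forall z, op_value o x y z <-> z = opv o x y.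
Proof.
move=> [P [/is_prodE -> [rel fn]]] xR yR.
have [|v [[vR vv] Uv]] := fn (op x y); first by apply/op_in_prd.
have E z : op_value o x y z <-> z = v.
  rewrite op_valueE; split=> [H|->]; last exact/relatedE.
  have [a [b [_ [bR /is_opairE /op_inj [_ E]]]]] := rel _ H; subst b.
  by symmetry; apply: Uv; split=> //; apply/relatedE.
have -> : opv o x y = v by apply: the_eq => [|z]; rewrite E.
by split.
Qed.

End BinaryOperation.

#[export] Hint Resolve DT_opv : dfn.

Section RealField.
Context {M : set_structure} {HZF : ZF M} {R add mul lt zero one : M}.
Variable HR : real_numbers R add mul lt zero one.

(** The elements of the model's real line, as a type. *)
Definition real_type (_ : real_numbers R add mul lt zero one) : Type := {x : M | x ∈ R}.
Local Notation K := (real_type HR).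

(** The underlying element of the model. *)
Definition rval (a : K) : M := sval a.

Lemma rval_in a : rval a ∈ R. Proof. by case: a. Qed.
Hint Resolve rval_in : core.

Lemma rval_inj a b : rval a = rval b -> a = b.
Proof. by case: a b => [x Hx] [y Hy] /= E; subst y; congr exist; exact: Prop_irrelevance. Qed.

Lemma rval_surj x : x ∈ R -> exists a : K, rval a = x.
Proof. by move=> Hx; exists (exist (fun x => x ∈ R) x Hx). Qed.

Lemma add_in (a b : K) : opv add (rval a) (rval b) ∈ R.
Proof. by case: (opvP (real_add HR) (rval_in a) (rval_in b)). Qed.
Lemma mul_in (a b : K) : opv mul (rval a) (rval b) ∈ R.
Proof. by case: (opvP (real_mul HR) (rval_in a) (rval_in b)). Qed.

(** The field operations. *)
Definition radd (a b : K) : K := exist (fun x => x ∈ R) _ (add_in a b).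
Definition rmul (a b : K) : K := exist (fun x => x ∈ R) _ (mul_in a b).
Definition rzero : K := exist (fun x => x ∈ R) zero (real_zero HR).
Definition rone : K := exist (fun x => x ∈ R) one (real_one HR).
Definition rlt (a b : K) : bool := `[< related lt (rval a) (rval b) >].

Lemma addE a b c : op_value add (rval a) (rval b) (rval c) <-> c = radd a b.
Proof.
have [_ H] := opvP (real_add HR) (rval_in a) (rval_in b).
by rewrite H; split=> [E|-> //]; apply: rval_inj.
Qed.
Lemma mulE a b c : op_value mul (rval a) (rval b) (rval c) <-> c = rmul a b.
Proof.
have [_ H] := opvP (real_mul HR) (rval_in a) (rval_in b).
by rewrite H; split=> [E|-> //]; apply: rval_inj.
Qed.

Lemma raddC : commutative radd.
Proof. by move=> a b; apply/addE/(real_addC HR) => //; apply/addE. Qed.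
Lemma rmulC : commutative rmul.
Proof. by move=> a b; apply/mulE/(real_mulC HR) => //; apply/mulE. Qed.
Lemma raddA : associative radd.
Proof.
move=> a b c; symmetry; apply/addE.
by apply: (real_addA HR (x := rval a) (y := rval b) (z := rval c)
  (u := rval (radd a b)) (v := rval (radd b c))) => //; apply/addE.
Qed.
Lemma rmulA : associative rmul.
Proof.
move=> a b c; symmetry; apply/mulE.
by apply: (real_mulA HR (x := rval a) (y := rval b) (z := rval c)
  (u := rval (rmul a b)) (v := rval (rmul b c))) => //; apply/mulE.
Qed.
Lemma radd0 : right_id rzero radd.
Proof. by move=> a; symmetry; apply/addE/(real_add0 HR). Qed.
Lemma rmul1 : right_id rone rmul.
Proof. by move=> a; symmetry; apply/mulE/(real_mul1 HR). Qed.
Lemma ropp_ex (a : K) : exists b, radd b a = rzero.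
Proof.
have [y [yR H]] := real_opp HR (rval_in a); have [b E] := rval_surj yR; subst y.
by exists b; rewrite raddC; symmetry; apply/addE.
Qed.
Definition ropp a : K := sval (cid (ropp_ex a)).
Lemma raddN : left_inverse rzero ropp radd.
Proof. by move=> a; rewrite /ropp; case: cid. Qed.
Lemma rinv_ex (a : K) : exists b, (a <> rzero -> rmul b a = rone) /\ (a = rzero -> b = rzero).
Proof.
case: (pselect (a = rzero)) => [->|N]; first by exists rzero.
have [|y [yR H]] := real_inv HR (rval_in a); first by move=> E; apply/N/rval_inj.
have [b E] := rval_surj yR; subst y.
by exists b; split=> // _; rewrite rmulC; symmetry; apply/mulE.
Qed.
Definition rinv a : K := sval (cid (rinv_ex a)).
Lemma rdistr : left_distributive rmul radd.
Proof.
move=> a b c; apply/addE.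
by apply: (real_distr HR (x := rval c) (y := rval a) (z := rval b)
  (s := rval (radd a b))) => //; first [exact/addE | apply/mulE; exact: rmulC].
Qed.

HB.instance Definition _ := gen_eqMixin K.
HB.instance Definition _ := gen_choiceMixin K.
HB.instance Definition _ := GRing.isZmodule.Build K raddA raddC
  (fun a => etrans (raddC _ _) (radd0 a)) raddN.

Lemma rone_neq0 : rone != 0%R :> K.
Proof. by apply/eqP => /(congr1 rval) /(real_one_neq_zero HR). Qed.

HB.instance Definition _ := GRing.Zmodule_isComNzRing.Build K rmulA rmulC
  (fun a => etrans (rmulC _ _) (rmul1 a)) rdistr rone_neq0.

Lemma rmulVf (a : K) : (a != 0 -> rinv a * a = 1)%R.
Proof. by move=> /eqP N; rewrite /rinv; case: cid => b [/= H _]; apply: H. Qed.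
Lemma rinv0 : rinv 0%R = 0%R.
Proof. by rewrite /rinv; case: cid => b [_ /=]; apply. Qed.

HB.instance Definition _ := GRing.ComNzRing_isField.Build K rmulVf rinv0.

Definition rle (a b : K) : bool := (a == b) || rlt a b.
Definition rnorm (a : K) : K := if rlt a 0%R then (- a)%R else a.

Lemma rltP a b : reflect (related lt (rval a) (rval b)) (rlt a b).
Proof. exact: asboolP. Qed.

Lemma rlt_irr a : rlt a a = false.
Proof. by apply/rltP/(real_lt_irrefl HR). Qed.
Lemma rlt_trans a b c : rlt a b -> rlt b c -> rlt a c.
Proof. by move=> /rltP H /rltP K; apply/rltP/(real_lt_trans HR _ _ _ H K). Qed.
Lemma rlt_total a b : rlt a b \/ a = b \/ rlt b a.
Proof.
case: (real_lt_total HR (rval_in a) (rval_in b)) => [/rltP|[/rval_inj|/rltP]]; tauto.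
Qed.
Lemma rlt_add a b c : rlt a b -> rlt (a + c)%R (b + c)%R.
Proof.
move=> /rltP H; apply/rltP.
by apply: (real_lt_add HR _ _ _ H (z := rval c)) => //; apply/addE.
Qed.
Lemma rlt0_mul a b : rlt 0%R a -> rlt 0%R b -> rlt 0%R (a * b)%R.
Proof.
move=> /rltP Ha /rltP Hb; apply/rltP.
by apply: (real_lt_mul HR _ _ Ha Hb) => //; apply/mulE.
Qed.

Import GRing.Theory.

Lemma rlt0_add a b : rlt 0%R a -> rlt 0%R b -> rlt 0%R (a + b)%R.
Proof. by move=> Ha /(rlt_add a); rewrite add0r addrC; apply: rlt_trans. Qed.
Lemma rlt0_ngt0 a : rlt 0%R a -> ~~ rlt a 0%R.
Proof. by move=> Ha; apply/negP => /(rlt_trans Ha); rewrite rlt_irr. Qed.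
Lemma rsub_gt0 a b : rlt 0%R (b - a)%R = rlt a b.
Proof.
apply/idP/idP => [/(rlt_add a)|/(rlt_add (- a)%R)].
- by rewrite add0r addrNK.
- by rewrite addrN.
Qed.
Lemma rlt0_total a : (a != 0)%R -> rlt 0%R a || rlt a 0%R.
Proof. by move=> /eqP N; apply/orP; case: (rlt_total 0%R a) => [|[/esym|]]; tauto. Qed.
Lemma rlt0N a : rlt (- a)%R 0%R = rlt 0%R a.
Proof. by rewrite -rsub_gt0 sub0r opprK. Qed.
Lemma rnormN a : rnorm (- a)%R = rnorm a.
Proof.
rewrite /rnorm rlt0N opprK; case: (rlt_total 0%R a) => [H|[<-|H]].
- by rewrite H (negbTE (rlt0_ngt0 H)).
- by rewrite rlt_irr oppr0.
- by rewrite H ifF //; apply/negP => /rlt0_ngt0; rewrite H.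
Qed.
Lemma rge0_norm a : rle 0%R a -> rnorm a = a.
Proof. by rewrite /rnorm => /orP [/eqP <-|/rlt0_ngt0 /negbTE ->] //; rewrite rlt_irr. Qed.

HB.instance Definition _ := Num.IntegralDomain_isLtReal.Build K rlt0_add rlt0_mul
  rlt0_ngt0 rsub_gt0 rlt0_total rnormN rge0_norm (fun _ _ => erefl).

End RealField.

(** * An embedding of the line into an interval of length 1 *)

Section Squeeze.
Import Order.TTheory GRing.Theory Num.Theory.
Local Open Scope ring_scope.
Variable K : realFieldType.
Implicit Types x y : K.

(** An injection of the line into the interval from [-1/2] to [1/2]. *)
Definition squeeze x : K := x / (1 + `|x|) / 2.

Lemma squeeze_norm x : `|squeeze x| < 1 / 2.
Proof.
have H0 := normr_ge0 x.
have H : `|x| / (1 + `|x|) < 1 by rewrite ltr_pdivrMr; lra.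
rewrite /squeeze !normrM !normfV (ger0_norm (x := 1 + _)); last lra.
by rewrite (ger0_norm (x := 2)); lra.
Qed.

Lemma squeezeE x z : z = squeeze x <-> (z + z) * (1 + `|x|) = x.
Proof.
have H0 := normr_ge0 x; have N : 1 + `|x| != 0 by rewrite gt_eqF //; lra.
rewrite /squeeze; split=> [->|E]; first by field.
by rewrite -[X in X / _ / _]E; field.
Qed.

(** The same equation without absolute value. *)
Lemma squeezeP x z : z = squeeze x <->
  (x < 0 /\ z + z = x + (z + z) * x) \/ (~ x < 0 /\ (z + z) + (z + z) * x = x).
Proof.
rewrite squeezeE; case: (ltP x 0) => Hx.
- rewrite ltr0_norm //; split=> [E|[[_ E]|[]]] //; last lra.
  by left; split=> //; lra.
- rewrite ger0_norm //; split=> [E|[[]|[_ E]]] //; last lra.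
  by right; split=> //; lra.
Qed.

Lemma squeeze_inj x y : squeeze x = squeeze y -> x = y.
Proof.
move=> E; have /squeezeE Ex := erefl (squeeze x); have /squeezeE Ey := E.
have Hz := squeeze_norm x; set z := squeeze x in Ex Ey Hz.
(* [|x| = 2|z| / (1 - 2|z|)] *)
have norm_eq w : (z + z) * (1 + `|w|) = w -> `|w| * (1 - `|z| * 2) = `|z| * 2.
  move=> Ew; have := congr1 Num.norm Ew.
  rewrite normrM (ger0_norm (x := 1 + _)); last by have := normr_ge0 w; lra.
  by rewrite -mulr2n normrMn -mulr_natr => H; lra.
have Exy : `|x| = `|y|.
  have N : 1 - `|z| * 2 != 0 by rewrite gt_eqF //; lra.
  by apply: (mulIf N); rewrite (norm_eq x Ex) (norm_eq y Ey).
by rewrite -Ex -Ey Exy.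
Qed.

End Squeeze.

(** * The topology of the real line *)

Section RealLine.
Import Order.TTheory GRing.Theory Num.Theory.
Local Open Scope ring_scope.
Context {M : set_structure} {HZF : ZF M} {R add mul lt zero one : M}.
Variable HR : real_numbers R add mul lt zero one.
Local Notation K := (real_type HR).
Local Notation val := (@rval M R add mul lt zero one HR).

Lemma rvalD (a b : K) : val (a + b) = opv add (val a) (val b). Proof. by []. Qed.
Lemma rvalM (a b : K) : val (a * b) = opv mul (val a) (val b). Proof. by []. Qed.

Lemma ltE (a b : K) : related lt (val a) (val b) <-> a < b.
Proof. by split=> /rltP. Qed.

Lemma leE (a b : K) : related lt (val a) (val b) \/ val a = val b <-> a <= b.
Proof.
rewrite ltE le_eqVlt; split=> [[->|/rval_inj ->]|/orP [/eqP ->|]]; rewrite ?eqxx ?orbT //; tauto.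
Qed.

(** ** The natural numbers of the line *)

(** The real number [n], as an element of the model. *)
Definition natR n : M := recf zero (fun x => opv add x one) n.

Lemma DT_natR : DT1 natR.
Proof. by apply: DT_recf; dfn. Qed.
Hint Resolve DT_natR : dfn.

Lemma add_one_in x : x ∈ R -> opv add x one ∈ R.
Proof. by move=> xR; case: (opvP (real_add HR) xR (real_one HR)). Qed.

Lemma natR_in n : n ∈ om -> natR n ∈ R.
Proof.
have DH : DT1 (fun x => opv add x one) by dfn.
exact: (recf_in DH (real_zero HR) add_one_in).
Qed.

(** An element of the line as a field element; [0] outside the line. *)
Definition toK (x : M) : K :=
  if pselect (x ∈ R) is left H then exist (fun x => x ∈ R) x H else 0.

Lemma toKE x : x ∈ R -> val (toK x) = x.
Proof. by rewrite /toK; case: pselect. Qed.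

(** The real number [n], as a field element. *)
Definition natK n : K := toK (natR n).

Lemma natKE n : n ∈ om -> val (natK n) = natR n.
Proof. by move=> /natR_in /toKE. Qed.

Lemma natK0 : natK empt = 0.
Proof.
have DH : DT1 (fun x => opv add x one) by dfn.
apply: rval_inj; rewrite natKE; last exact: om0.
exact: (recf0 DH (real_zero HR) add_one_in).
Qed.

Lemma natKS n : n ∈ om -> natK (sc n) = natK n + 1.
Proof.
have DH : DT1 (fun x => opv add x one) by dfn.
move=> Hn; apply: rval_inj; rewrite rvalD !natKE //; last exact: omS.
exact: (recfS DH (real_zero HR) add_one_in).
Qed.

Lemma natK_mono n m : n ∈ om -> m ∈ n -> natK m + 1 <= natK n.
Proof.
have Dle : D2 (fun x y => related lt x y \/ x = y) by dfn.
move=> Hn Hm; have Hmo := om_trans Hn Hm; rewrite -natKS //.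
apply/leE; rewrite !natKE //; last exact: omS.
move: n Hn m Hm Hmo; apply: om_ind; first by dfn.
- by move=> m /in_empt.
- move=> n Hn IH m /in_sc [mn|->] Hm; last by right.
  have := IH m mn Hm; rewrite -!natKE //; [|exact: omS..].
  by move=> /leE H; apply/leE; rewrite (natKS Hn); lra.
Qed.

Lemma natK_dist n m : n ∈ om -> m ∈ om -> n <> m -> 1 <= `|natK n - natK m|.
Proof.
move=> Hn Hm N; case: (om_total Hn Hm) => [nm|[//|mn]].
- by have := natK_mono Hm nm => H; rewrite ltr0_norm; lra.
- by have := natK_mono Hn mn => H; rewrite ger0_norm; lra.
Qed.

(** If the natural numbers were bounded with supremum [s], then [s - 1] would be
    another upper bound. *)
Lemma archimedean (a : K) : exists n, n ∈ om /\ a < natK n.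
Proof.
apply: contrapT => N.
have ub n : n ∈ om -> natK n <= a.
  by move=> Hn; rewrite leNgt; apply/negP => H; apply: N; exists n.
have HS x : x ∈ img om natR <-> exists n, n ∈ om /\ x = natR n by apply: imgE; dfn.
have ubE (b : K) : upper_bound R lt (img om natR) (val b) <-> forall n, n ∈ om -> natK n <= b.
  split=> [[_ H] n Hn|H].
    by apply/leE; rewrite natKE //; apply: H; apply/HS; exists n.
  split; first exact: rval_in.
  by move=> x /HS [n [Hn ->]]; rewrite -natKE //; apply/leE/H.
have [|||s [us ls]] := real_complete HR (S := img om natR).
- by move=> x /HS [n [Hn ->]]; exact: natR_in.
- by exists (natR empt); apply/HS; exists empt; split=> //; exact: om0.
- by exists (val a); apply/ubE.
have [sK Es] := rval_surj HR (proj1 us); subst s.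
have us' := iffLR (ubE sK) us.
have /ubE/ls/leE : forall n, n ∈ om -> natK n <= sK - 1.
  by move=> n Hn; have := us' _ (omS Hn); rewrite natKS //; lra.
lra.
Qed.

(** ** A countable dense set *)

(** [z = (a - b) / c], where [n] codes the triple [(a, b, c)]. *)
Definition names_rational n z : Prop := exists a b c k,
  a ∈ om /\ b ∈ om /\ c ∈ om /\ k ∈ om /\ walk n = op k c /\ walk k = op a b /\
  natR c <> zero /\ opv add (opv mul z (natR c)) (natR b) = natR a.

Lemma D_names_rational : D2 names_rational.
Proof. by unfold names_rational; dfn. Qed.
Hint Resolve D_names_rational : dfn.

(** The set of the quotients [(a - b) / c]. *)
Definition rationals : M := sep R (fun z => exists n, n ∈ om /\ names_rational n z).

Lemma in_rationals z : z ∈ rationals <-> z ∈ R /\ exists n, n ∈ om /\ names_rational n z.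
Proof. by apply: sepE; dfn. Qed.

Lemma cnt_rationals : cnt rationals.
Proof.
apply: (cnt_names D_names_rational) => [z /in_rationals []|] //.
move=> n z z' /in_rationals [zR _] /in_rationals [z'R _].
have [x Ex] := rval_surj HR zR; have [y Ey] := rval_surj HR z'R; subst z z'.
move=> [a [b [c [k [Ha [Hb [Hc [Hk [E1 [E2 [N E]]]]]]]]]]].
move=> [a' [b' [c' [k' [Ha' [Hb' [Hc' [Hk' [E1' [E2' [N' E']]]]]]]]]]].
move: E1'; rewrite E1 => /op_inj [Ek Ec]; subst k' c'.
move: E2'; rewrite E2 => /op_inj [Ea Eb]; subst a' b'.
move: N E; rewrite -E' -!natKE // -!rvalM -!rvalD => N /rval_inj /addIr E; congr rval.
by apply: mulIf E; apply/eqP => E0; apply: N; rewrite E0.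
Qed.

Lemma rationals_dense (x y : K) : x < y -> exists q : K, val q ∈ rationals /\ x < q < y.
Proof.
move=> xy; have d0 : 0 < y - x by lra.
have [c [Hc Lc]] := archimedean ((y - x)^-1).
have c0 : 0 < natK c by apply: lt_trans Lc; rewrite invr_gt0.
have Lc' : 1 < natK c * (y - x) by rewrite -(ltr_pdivrMr _ _ d0) div1r.
have [b [Hb Lb]] := archimedean (- (natK c * x)).
(* Were no natural number strictly between [c x + b] and [c y + b], all of them
   would lie below [c x + b]. *)
have [a [Ha /andP [La1 La2]]] : exists a, a ∈ om /\
    (natK c * x + natK b < natK a < natK c * y + natK b).
  apply: contrapT => N.
  have H a : a ∈ om -> related lt (natR a) (val (natK c * x + natK b)) \/
      natR a = val (natK c * x + natK b).
    move: a; apply: om_ind; first by dfn.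
    - rewrite -natKE; last exact: om0.
      by apply/leE; rewrite natK0; lra.
    - move=> a Ha; rewrite -!natKE //; last exact: omS.
      move=> /leE H; apply/leE; rewrite leNgt; apply/negP => H'.
      apply: N; exists (sc a); split; first exact: omS.
      by rewrite H' /= natKS //; lra.
  have [a [Ha La]] := archimedean (natK c * x + natK b).
  by move: (H a Ha); rewrite -natKE // => /leE; lra.
exists ((natK a - natK b) / natK c); split; last first.
  by rewrite ltr_pdivlMr // ltr_pdivrMr //; apply/andP; split; lra.
apply/in_rationals; split; first exact: rval_in.
have [k [Hk Ek]] := walk_surj Ha Hb; have [n [Hn En]] := walk_surj Hk Hc.
exists n; split=> //; exists a, b, c, k; do 6 split=> //; split.
- by rewrite -natKE // => /(@rval_inj _ _ _ _ _ _ _ HR _ 0) E; rewrite E ltxx in c0.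
- rewrite -!natKE // -rvalM -rvalD; congr rval.
  by rewrite divfK ?subrK // gt_eqF.
Qed.

(** ** The standard topology *)

(** The open interval between [a] and [b]. *)
Definition interval a b : M := sep R (fun y => related lt a y /\ related lt y b).

Lemma DT_interval : DT2 interval. Proof. by unfold interval; dfn. Qed.
Hint Resolve DT_interval : dfn.

Lemma in_interval (a b y : K) : val y ∈ interval (val a) (val b) <-> a < y < b.
Proof.
have -> : val y ∈ interval (val a) (val b) <->
    val y ∈ R /\ related lt (val a) (val y) /\ related lt (val y) (val b).
  by apply: sepE; dfn.
rewrite !ltE; split=> [[_ [-> ->]] //|/andP [? ?]].
by split=> //; exact: rval_in.
Qed.

Lemma interval_sub a b : interval a b ⊆ R.
Proof. by move=> x; rewrite sepE; [case|dfn]. Qed.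

(** Membership in the standard topology in terms of the field. *)
Lemma standardE T U : standard_topology R lt T -> U ∈ T <-> U ⊆ R /\
  forall x : K, val x ∈ U -> exists a b : K, a < x < b /\
    forall y : K, a < y < b -> val y ∈ U.
Proof.
move=> ->; split=> -[UR H]; split=> //.
- move=> x /H [a [b [aR [bR [ax [xb L]]]]]].
  have [a' E] := rval_surj HR aR; have [b' E'] := rval_surj HR bR; subst a b.
  exists a', b'; split; first by apply/andP; split; apply/ltE.
  by move=> y /andP [? ?]; apply: L; [exact: rval_in|apply/ltE..].
- move=> x /[dup] /UR xR; have [x' E] := rval_surj HR xR; subst x.
  move=> /H [a [b [/andP [ax xb] L]]]; exists (val a), (val b).
  do 2 (split; first exact: rval_in); do 2 (split; first exact/ltE).
  move=> y yR; have [y' E] := rval_surj HR yR; subst y.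
  by move=> /ltE ay /ltE yb; apply: L; rewrite ay.
Qed.

Lemma interval_open T (a b : K) : standard_topology R lt T -> interval (val a) (val b) ∈ T.
Proof.
move=> HT; apply/(standardE _ HT); split; first exact: interval_sub.
by move=> x /in_interval Hx; exists a, b; split=> // y Hy; apply/in_interval.
Qed.

Lemma standard_space T : standard_topology R lt T -> topological_space R T.
Proof.
move=> HT; have E U := standardE U HT; split.
- by move=> U /E [].
- by move=> U HU; apply/E; split=> [x /HU|x /HU].
- apply/E; split=> // x _; exists (x - 1), (x + 1); split; first by apply/andP; split; lra.
  by move=> y _; exact: rval_in.
- move=> U V W /E [UR HU] /E [VR HV] HW; apply/E; split=> [x /HW [/UR]|x /HW [xU xV]] //.
  have [a [b [/andP [ax xb] Hab]]] := HU x xU.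
  have [c [d [/andP [cx xd] Hcd]]] := HV x xV.
  exists (Num.max a c), (Num.min b d); split; first by rewrite gt_max lt_min ax xb cx xd.
  move=> y; rewrite gt_max lt_min => /andP [/andP [ay cy] /andP [yb yd]].
  by apply/HW; split; [apply: Hab; rewrite ay|apply: Hcd; rewrite cy].
- move=> F U FT UF; apply/E; split=> [x /UF [V [/FT /E [VR _] /VR]]|x /UF [V [VF xV]]] //.
  have /E [_ HV] := FT V VF; have [a [b [ab H]]] := HV x xV.
  by exists a, b; split=> // y /H yV; apply/UF; exists V.
Qed.

Lemma standard_second_countable T : standard_topology R lt T -> second_countable T.
Proof.
move=> HT.
pose (P := fun U => exists p q, p ∈ rationals /\ q ∈ rationals /\ U = interval p q).
have DP : D1 P by unfold P; dfn.
have HB U : U ∈ sep (pow R) P <-> U ⊆ R /\ P U by rewrite sepE // in_pow.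
have ratR p : p ∈ rationals -> exists a : K, val a = p.
  by move=> /in_rationals [/(rval_surj HR)].
exists (sep (pow R) P); split; first (apply/is_baseE; split).
- move=> U /HB [_ [p [q [/ratR [a <-] [/ratR [b <-] ->]]]]].
  exact: interval_open.
- move=> U x /(standardE _ HT) [UR HU] xU.
  have [x' Ex] := rval_surj HR (UR x xU); subst x.
  have [a [b [/andP [ax xb] Hab]]] := HU x' xU.
  have [p [pQ /andP [ap px]]] := rationals_dense ax.
  have [q [qQ /andP [xq qb]]] := rationals_dense xb.
  exists (interval (val p) (val q)); split.
    by apply/HB; split; [exact: interval_sub|exists (val p), (val q)].
  split; first by apply/in_interval; rewrite px.
  move=> y /[dup] /interval_sub yR; have [y' Ey] := rval_surj HR yR; subst y.
  move=> /in_interval /andP [py yq]; apply: Hab.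
  by rewrite (lt_trans ap py) (lt_trans yq qb).
- apply/countableE; apply: (cnt_img2 (G := interval) _ cnt_rationals cnt_rationals).
    by dfn.
  by move=> U /HB [_].
Qed.

Lemma second_condensation_real :
  second_countable_condensation M -> real_condensation R lt.
Proof.
move=> H T HT; apply: H; first exact: standard_space.
exact: standard_second_countable.
Qed.

Lemma standard_topology_ex : exists T, standard_topology R lt T.
Proof.
exists (sep (pow R) (fun U => forall x, x ∈ U -> exists a b,
      a ∈ R /\ b ∈ R /\ related lt a x /\ related lt x b /\
      forall y, y ∈ R -> related lt a y -> related lt y b -> y ∈ U)).
by move=> U; rewrite -in_pow; apply: sepE; dfn.
Qed.

(** ** Spreading countably many sets of reals over disjoint intervals *)

(** The graph of [squeeze] inside the model, by the equation of [squeezeP]. *)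
Definition squeeze_rel x z : Prop := z ∈ R /\
  ((related lt x zero /\ opv add z z = opv add x (opv mul (opv add z z) x)) \/
   (~ related lt x zero /\ opv add (opv add z z) (opv mul (opv add z z) x) = x)).

Definition squeezeM x : M := the (squeeze_rel x).

Lemma DT_squeezeM : DT1 squeezeM.
Proof. by unfold squeezeM, squeeze_rel; dfn. Qed.
Hint Resolve DT_squeezeM : dfn.

Lemma squeezeME (x : K) : squeezeM (val x) = val (squeeze x).
Proof.
have E z : squeeze_rel (val x) (val z) <-> z = squeeze x.
  rewrite squeezeP /squeeze_rel -!rvalD -!rvalM -!rvalD (ltE x 0).
  split=> [[_ [[? /rval_inj ?]|[? /rval_inj ?]]]|H]; [by left|by right|].
  split; first exact: rval_in.
  by case: H => -[? E]; [left|right]; rewrite {1}E; split=> //; rewrite -?E.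
apply: the_eq; first exact/E.
by move=> z [zR]; have [z' Ez] := rval_surj HR zR; subst z => H; congr rval; apply/E; split.
Qed.

Lemma squeeze_bounds (x : K) : - (1 / 2) < squeeze x < 1 / 2.
Proof. by rewrite -ltr_norml; exact: squeeze_norm. Qed.

Section Spread.
Variables (F : M) (J : M -> M).
Hypotheses (DJ : DT1 J) (Jom : forall a, a ∈ F -> J a ∈ om)
  (Jinj : forall a b, a ∈ F -> b ∈ F -> J a = J b -> a = b)
  (FR : forall a, a ∈ F -> a ⊆ R).

(** The copy of the real [x] in the interval of length 1 around the number of [a]. *)
Definition spread a x : M := opv add (natR (J a)) (squeezeM x).

Lemma DT_spread : DT2 spread. Proof. by unfold spread; dfn. Qed.
Hint Resolve DT_spread : dfn.

Lemma spreadE a (x : K) : a ∈ F -> spread a (val x) = val (natK (J a) + squeeze x).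
Proof. by move=> /Jom Ha; rewrite /spread squeezeME -natKE. Qed.

Lemma spread_dist a b (x z : K) : a ∈ F -> b ∈ F -> val z = spread b (val x) ->
  `|z - natK (J a)| < 1 / 2 -> a = b.
Proof.
move=> aF bF; rewrite spreadE // => /rval_inj -> H.
apply: Jinj => //; apply: contrapT => N.
have := natK_dist (Jom aF) (Jom bF) N.
move: H (squeeze_bounds x); rewrite ltr_norml ler_normr.
by move=> /andP [? ?] /andP [? ?] /orP []; lra.
Qed.

Lemma spread_inj a b x y : a ∈ F -> b ∈ F -> x ∈ a -> y ∈ b ->
  spread a x = spread b y -> a = b /\ x = y.
Proof.
move=> aF bF xa yb.
have [x' Ex] := rval_surj HR (FR aF xa); have [y' Ey] := rval_surj HR (FR bF yb); subst x y => E.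
have Eab : a = b.
  apply: (spread_dist (z := natK (J a) + squeeze x') aF bF); first by rewrite -spreadE; [exact: E|].
  by rewrite addrAC subrr add0r; exact: squeeze_norm.
split; first exact: Eab.
subst b; move: E; rewrite (spreadE _ aF) (spreadE _ aF) => /rval_inj /addrI /squeeze_inj E.
by rewrite E.
Qed.

(** The union of the copies of the members of [F]. *)
Definition spread_set : M := sep R (fun z => exists a x, a ∈ F /\ x ∈ a /\ z = spread a x).

Lemma in_spread_set z : z ∈ spread_set <-> z ∈ R /\ exists a x, a ∈ F /\ x ∈ a /\ z = spread a x.
Proof. by apply: sepE; dfn. Qed.

Lemma spread_in a x : a ∈ F -> x ∈ a -> spread a x ∈ spread_set.
Proof.
move=> aF xa; apply/in_spread_set; split; last by exists a, x.
by have [x' <-] := rval_surj HR (FR aF xa); rewrite spreadE //; exact: rval_in.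
Qed.

(** Each member of [F] is copied into an interval that meets no other copy, so a
    point of the union of the copies does not condense. *)
Lemma spread_set_cnt : real_condensation R lt -> (forall a, a ∈ F -> cnt a) -> cnt spread_set.
Proof.
move=> H CF; have [T HT] := standard_topology_ex.
have SR : spread_set ⊆ R by move=> z /in_spread_set [].
apply: contrapT => N; have [|z [zS [_ Cz]]] := H T HT _ SR.
  by move=> /countableE.
have /in_spread_set [zR [a [x [aF [xa Ez]]]]] := zS.
have [x' Ex] := rval_surj HR (FR aF xa); subst x.
pose (U := interval (val (natK (J a) - 1 / 2)) (val (natK (J a) + 1 / 2))).
have [||I [/is_interE -> ]] := Cz U.
- exact: interval_open.
- rewrite Ez spreadE //; apply/in_interval.
  by move/andP: (squeeze_bounds x') => [? ?]; apply/andP; split; lra.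
apply; apply/countableE; apply: (cnt_img (G := spread a) _ (CF a aF)); first by dfn.
move=> w /in_cap [/in_spread_set [wR [b [y [bF [yb Ew]]]]] wU].
exists y; suff -> : a = b by [].
have [w' E] := rval_surj HR wR; have [y' E'] := rval_surj HR (FR bF yb); subst w y.
apply: (spread_dist aF bF E); rewrite ltr_norml.
by move: wU; rewrite -E => /in_interval /andP [? ?]; apply/andP; split; lra.
Qed.

(** A numbering [C] of the union of the copies selects in each member of [F] the
    element whose copy has the least number. *)
Lemma spread_choice : cnt spread_set -> (forall a, a ∈ F -> exists x, x ∈ a) ->
  exists f, is_choice_function f F.
Proof.
move=> [C [DC [Com Cinj]]] ne.
pose (Q := fun a x => x ∈ a /\
  is_least (fun n => exists y, y ∈ a /\ n = C (spread a y)) (C (spread a x))).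
have DQ : D2 Q by unfold Q, is_least; dfn.
pose (f := sep (prd F (bun F)) (fun p => exists a x, p = op a x /\ Q a x)).
have Hf a x : op a x ∈ f <-> (a ∈ F /\ x ∈ bun F) /\ Q a x.
  rewrite sepE ?op_in_prd; last by dfn.
  split=> -[? H]; split=> //; last by exists a, x.
  by case: H => a' [x' [/op_inj [-> ->]]].
have inF a x : a ∈ F -> x ∈ a -> x ∈ bun F by move=> aF xa; apply/in_bun; exists a.
exists f, (bun F); split; first exact/is_unionE; split; first split.
- move=> p; rewrite sepE; last by dfn.
  by move=> [/in_prd [a [x [aF [xF ->]]]] _]; exists a, x; split=> //; split=> //; exact/opP.
- move=> a aF; have [x0 xa0] := ne a aF.
  have [||n Hn] := least_ex (P := fun n => exists y, y ∈ a /\ n = C (spread a y)).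
  + by dfn.
  + by exists (C (spread a x0)); split; [exact/Com/spread_in|exists x0].
  + have [_ [[x [xa En]] _]] := Hn; subst n.
    exists x; split.
      split; first exact: (inF a).
      by apply/relatedE/Hf; split=> //; split=> //; apply: (inF a).
    move=> y [_ /relatedE /Hf [_ [ya Ly]]].
    have /Cinj E := least_uniq Hn Ly.
    by case: (spread_inj aF aF xa ya (E (spread_in aF xa) (spread_in aF ya))).
- by move=> a x aF /relatedE /Hf [_ []].
Qed.

End Spread.

Lemma real_condensation_choice : real_condensation R lt -> CAC_omega R.
Proof.
move=> H F [/countableE [J [DJ [Jom Jinj]]] _] HF.
have FR a : a ∈ F -> a ⊆ R by move=> /HF [].
apply: (spread_choice DJ Jom Jinj FR); last by move=> a /HF [_ []].
apply: (spread_set_cnt DJ Jom Jinj FR H).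
by move=> a /HF [_ [/countableE]].
Qed.

End RealLine.

Theorem theorem5p1 (M : set_structure) (HZF : ZF M) :
  (CUC M <-> cuf_base_condensation M) /\
  (cuf_base_condensation M <-> second_countable_condensation M) /\
  (CUC M <-> second_countable_condensation M) /\
  (forall R add mul lt zero one : M, real_numbers R add mul lt zero one ->
     (second_countable_condensation M -> real_condensation R lt) /\
     (real_condensation R lt -> CAC_omega R)).
Proof.
have H12 := @CUC_condensation M HZF.
have H23 := @cuf_second_condensation M HZF.
have H31 := @second_condensation_CUC M HZF.
split; first by split; eauto.
split; first by split; eauto.
split; first by split; eauto.
move=> R add mul lt zero one HR; split.
- exact: second_condensation_real HR.
- exact: real_condensation_choice HR.
Qed.
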